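(* There exists a family $(\Sigma_\delta)_{\delta>1}$ (indexed by real numbers $\delta>1$) of geometrically infinite hyperbolic surfaces such that for each surface $\Sigma_\delta$ of the family there exists $u_0\in\Omega_h\subset T^1\Sigma_\delta$ satisfying: 1. $h_{\mathbb{R}}(u_0)$ is an irregular orbit of the horocyclic flow on $T^1\Sigma_\delta$ with asymptotic fineness $Inj(u_0(\mathbb{R}_+))=+\infty$, and the closure $\overline{h_{\mathbb{R}}(u_0)}$ is not $h_{\mathbb{R}}$-minimal; 2. the set $T_{u_0}=\{t\in\mathbb{R}\setminus\{0\} : g_t(u_0)\in\overline{h_{\mathbb{R}}(u_0)}\}$ contains a sequence $(t_n)_{n\ge 1}$ with $t_n\to+\infty$.
   Context: $\mathbb{H}$ is the Poincaré upper half-plane with hyperbolic distance $d$. A hyperbolic surface is $\Sigma=\Gamma\backslash\mathbb{H}$ with $\Gamma$ a Fuchsian group without elliptic element; it is geometrically infinite if it is not geometrically finite. $T^1\Sigma$ is its unit tangent bundle, $g_{\mathbb{R}}=(g_t)_{t\in\mathbb{R}}$ is the geodesic flow on $T^1\Sigma$, and $h_{\mathbb{R}}=(h_s)_{s\in\mathbb{R}}$ is the horocyclic flow on $T^1\Sigma$: on $T^1\mathbb{H}$ it moves a unit vector $\tilde u$ with forward endpoint $\tilde u(\infty)\in\partial\mathbb{H}$ by arc length $s$ along the horocycle centered at $\tilde u(\infty)$ through the base point of $\tilde u$, keeping the forward endpoint $\tilde u(\infty)$. $h_{\mathbb{R}}(u)$ denotes the orbit of $u$, and $\Omega_h\subset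 T^1\Sigma$ is the non-wandering set of $h_{\mathbb{R}}$. An orbit $h_{\mathbb{R}}(u)$, $u\in\Omega_h$, is irregular if it is neither closed nor dense in $\Omega_h$. A set is $h_{\mathbb{R}}$-minimal if it is non-empty, closed and $h_{\mathbb{R}}$-invariant and contains no proper non-empty closed $h_{\mathbb{R}}$-invariant subset. For $x\in\Sigma$ with lift $\tilde x\in\mathbb{H}$, $Inj(x)=\inf_{\gamma\in\Gamma\setminus\{Id\}}d(\tilde x,\gamma(\tilde x))$. For $u\in T^1\Sigma$, $u(t)\in\Sigma$ ($t\ge0$) is the arc-length parametrized geodesic ray determined by $u$, with image $u(\mathbb{R}_+)$, and its asymptotic fineness is $Inj(u(\mathbb{R}_+))=\liminf_{t\to+\infty}Inj(u(t))$. *)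

(* Defs.v *)
From HB Require Import structures.
From mathcomp Require Import all_boot all_order all_algebra.
From mathcomp Require Import all_classical all_reals all_analysis.
From mathcomp Require Import generic_quotient.
From mathcomp Require Import complex ring lra.
Set Implicit Arguments.
Unset Strict Implicit.
Unset Printing Implicit Defensive.
Import Order.TTheory GRing.Theory Num.Theory numFieldNormedType.Exports.

Local Open Scope classical_set_scope.
Local Open Scope ring_scope.
Local Open Scope complex_scope.
Local Open Scope quotient_scope.

Notation Re := complex.Re.
Notation Im := complex.Im.

(* The library puts no topology on R[i]; this is the one of R * R. *)
HB.instance Definition _ (R : realType) := Topological.copy R[i]
  (initial_topology (fun z : R[i] => (Re z, Im z) : R * R)).

Section HyperbolicPlane.
Variable R : realType.
Implicit Types (A B : 'M[R]_2) (z w v : R[i]) (s t : R).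

Definition sqnorm z : R := Re z ^+ 2 + Im z ^+ 2.

Definition upper_half_plane : set R[i] := [set z | 0 < Im z].
Definition plane : Type := set_type upper_half_plane.
HB.instance Definition _ := Topological.on plane.
HB.instance Definition _ := SubType.on plane.

Definition acosh (x : R) : R := ln (x + Num.sqrt (x ^+ 2 - 1)).

Definition hdist (z w : plane) : R :=
  acosh (1 + sqnorm (val z - val w) / (2 * Im (val z) * Im (val w))).

(* A pair (z, v) is a tangent vector v at z; its hyperbolic norm is |v| / Im z,
   so it is a unit vector when |v| = Im z. *)
Definition unit_tangent_vectors : set (R[i] * R[i]) :=
  [set u | 0 < Im u.1 /\ sqnorm u.2 = Im u.1 ^+ 2].
Definition T1plane : Type := set_type unit_tangent_vectors.
HB.instance Definition _ := Topological.on T1plane.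
HB.instance Definition _ := SubType.on T1plane.

Definition mobius_num A z : R[i] := (A 0 0)%:C * z + (A 0 1)%:C.
Definition mobius_den A z : R[i] := (A 1 0)%:C * z + (A 1 1)%:C.
Definition mobius A z : R[i] := mobius_num A z / mobius_den A z.
(* The derivative of a Moebius map of determinant 1 is (c z + d)^-2. *)
Definition dmobius A (u : R[i] * R[i]) : R[i] * R[i] :=
  (mobius A u.1, u.2 / mobius_den A u.1 ^+ 2).

(* When \det A = 1 the default values of insubd are not used: see val_act and
   val_dact below. *)
Definition act A (z : plane) : plane := insubd z (mobius A (val z)).
Definition dact A (u : T1plane) : T1plane := insubd u (dmobius A (val u)).

Lemma sqnormM z w : sqnorm (z * w) = sqnorm z * sqnorm w.
Proof. by case: z w => a b [c d]; rewrite /sqnorm /=; ring. Qed.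

Lemma sqnorm_gt0 z : (0 < sqnorm z) = (z != 0).
Proof.
case: z => a b; rewrite /sqnorm eq_complex /= lt_neqAle addr_ge0 ?sqr_ge0//.
by rewrite andbT eq_sym paddr_eq0 ?sqr_ge0// !expf_eq0.
Qed.

Lemma sqnormV z : sqnorm z^-1 = (sqnorm z)^-1.
Proof.
have [->|z0] := eqVneq z 0; first by rewrite invr0 /sqnorm /= expr0n addr0 invr0.
have := sqnorm_gt0 z; rewrite z0 => s0.
apply: (mulfI (lt0r_neq0 s0)); rewrite -sqnormM (divff z0).
by rewrite divff ?lt0r_neq0// /sqnorm /= expr0n expr1n addr0.
Qed.

Lemma det2 A : \det A = A 0 0 * A 1 1 - A 0 1 * A 1 0.
Proof.
rewrite (expand_det_row _ 0) !big_ord_recl big_ord0 /cofactor !det_mx11 !mxE /=.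
rewrite addr0 expr0 mul1r expr1 mulN1r mulrN.
by congr (A 0 _ * A _ _ - A 0 _ * A _ _); apply/val_inj.
Qed.

Lemma mobius_den_neq0 A z : \det A = 1 -> 0 < Im z -> mobius_den A z != 0.
Proof.
rewrite det2 => dA z0; apply/negP; case: z z0 => x y /= y0.
rewrite eq_complex /= => /andP[/eqP h1 /eqP h2].
have /eqP : A 1 0 * y = 0 by lra.
rewrite mulf_eq0 (gt_eqF y0) orbF => /eqP c0.
move: h1 dA; rewrite c0 => h1.
have -> : A 1 1 = 0 by lra.
by rewrite !mulr0 subrr => /eqP; rewrite eq_sym oner_eq0.
Qed.

Lemma Im_div z w : Im (z / w) = (Im z * Re w - Re z * Im w) / sqnorm w.
Proof. by case: z w => a b [c d]; rewrite /sqnorm /=; ring. Qed.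

Lemma Im_mobius A z : \det A = 1 -> 0 < Im z ->
  Im (mobius A z) = Im z / sqnorm (mobius_den A z).
Proof.
move=> dA z0; rewrite /mobius Im_div; congr (_ / _).
rewrite -[RHS]mul1r -dA det2 /mobius_num /mobius_den.
case: z {z0} => x y /=; ring.
Qed.

Lemma val_act A (z : plane) : \det A = 1 -> val (act A z) = mobius A (val z).
Proof.
move=> dA; rewrite /act insubdK//.
have z0 : 0 < Im (val z) by have /set_mem := valP z.
rewrite inE /upper_half_plane /=.
by rewrite Im_mobius// divr_gt0// sqnorm_gt0 mobius_den_neq0.
Qed.

Lemma val_dact A (u : T1plane) : \det A = 1 -> val (dact A u) = dmobius A (val u).
Proof.
move=> dA; rewrite /dact insubdK//.
have [z0 nu] : unit_tangent_vectors (val u) by have /set_mem := valP u.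
rewrite inE /unit_tangent_vectors /=.
rewrite Im_mobius// divr_gt0// ?sqnorm_gt0 ?mobius_den_neq0//.
by rewrite sqnormM sqnormV nu expr2 sqnormM expr_div_n expr2.
Qed.


Lemma mobius_numM A B z : mobius_den B z != 0 ->
  mobius_num (A * B) z = mobius_num A (mobius B z) * mobius_den B z.
Proof.
move=> d0; rewrite /mobius [in RHS]/mobius_num mulrDl mulrA mulfVK//.
rewrite /mobius_num /mobius_den !mxE !big_ord_recl !big_ord0 !addr0 /=.
rewrite (_ : lift 0 0 = 1) ?rmorphD ?rmorphM /=; last exact/val_inj.
ring.
Qed.

Lemma mobius_denM A B z : mobius_den B z != 0 ->
  mobius_den (A * B) z = mobius_den A (mobius B z) * mobius_den B z.
Proof.
move=> d0; rewrite /mobius [in RHS]/mobius_den mulrDl mulrA mulfVK//.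
rewrite /mobius_num /mobius_den !mxE !big_ord_recl !big_ord0 !addr0 /=.
rewrite (_ : lift 0 0 = 1) ?rmorphD ?rmorphM /=; last exact/val_inj.
ring.
Qed.

Lemma mobiusM A B z : mobius_den B z != 0 ->
  mobius (A * B) z = mobius A (mobius B z).
Proof.
move=> d0; rewrite /mobius mobius_numM// mobius_denM//.
by rewrite -mulf_div divff// mulr1.
Qed.

Lemma mobius_num1 z : mobius_num 1 z = z.
Proof. by rewrite /mobius_num !mxE /= rmorph1 rmorph0 mul1r addr0. Qed.

Lemma mobius_den1 z : mobius_den 1 z = 1.
Proof. by rewrite /mobius_den !mxE /= rmorph1 rmorph0 mul0r add0r. Qed.

Lemma mobiusN A z : mobius (- A) z = mobius A z.
Proof.
rewrite /mobius /mobius_num /mobius_den !mxE !rmorphN !mulNr -!opprD.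
by rewrite invrN mulrNN.
Qed.

Lemma act1 (z : plane) : act 1 z = z.
Proof.
apply/val_inj; rewrite val_act ?det1//.
by rewrite /mobius mobius_num1 mobius_den1 divr1.
Qed.

Lemma dact1 (u : T1plane) : dact 1 u = u.
Proof.
apply/val_inj; rewrite val_dact ?det1// /dmobius.
rewrite /mobius mobius_num1 mobius_den1 expr1n !divr1.
by case: (val u).
Qed.

Lemma actM A B (z : plane) : \det A = 1 -> \det B = 1 -> act (A * B) z = act A (act B z).
Proof.
move=> dA dB; apply/val_inj.
rewrite !val_act ?det_mulmx ?dA ?dB ?mulr1// mobiusM//.
by rewrite mobius_den_neq0//; have /set_mem := valP z.
Qed.

Lemma dactM A B (u : T1plane) : \det A = 1 -> \det B = 1 ->
  dact (A * B) u = dact A (dact B u).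
Proof.
move=> dA dB; apply/val_inj.
have d0 : mobius_den B (val u).1 != 0.
  by rewrite mobius_den_neq0//; have /set_mem [] := valP u.
rewrite !val_dact ?det_mulmx ?dA ?dB ?mulr1// /dmobius /= mobiusM//.
by rewrite mobius_denM// exprMn invfM -mulrA (mulrC (_ ^-1)).
Qed.

Lemma dactN A (u : T1plane) : dact (- A) u = dact A u.
Proof.
rewrite /dact /dmobius mobiusN; congr (insubd u (_, _ / _)).
by rewrite /mobius_den !mxE !rmorphN !mulNr -!opprD sqrrN.
Qed.

Lemma tangent_bundle_subproof z v (h : 0 < Im z /\ sqnorm v = Im z ^+ 2) :
  (z, v) \in unit_tangent_vectors.
Proof. by rewrite inE. Qed.

Definition mkT1 z v h : T1plane := Sub (z, v) (@tangent_bundle_subproof z v h).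

Definition base_point (u : T1plane) : plane := Sub (val u).1
  (mem_set (proj1 (set_mem (valP u)))).

Lemma val_base_point (u : T1plane) : val (base_point u) = (val u).1.
Proof. exact: SubK. Qed.

Lemma expi_subproof t : 0 < Im (0 +i* expR t) /\
  sqnorm (0 +i* expR t) = Im (0 +i* expR t) ^+ 2.
Proof. by rewrite /= expR_gt0 /sqnorm /= expr0n add0r. Qed.

Lemma horo_subproof s : 0 < Im (s +i* 1) /\ sqnorm 'i = Im (s +i* 1) ^+ 2.
Proof. by rewrite /= ltr01 /sqnorm /= expr0n add0r. Qed.

(* The geodesic t |-> (e^t i, e^t i) and the horocycle s |-> (i + s, i),
   centered at oo, both through the vertical unit vector (i, i). *)
Definition vertical_geodesic t : T1plane := mkT1 (expi_subproof t).
Definition horizontal_horocycle s : T1plane := mkT1 (horo_subproof s).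

(* The matrix in SL(2, R), unique up to sign, which sends (i, i) to u = (z, v):
   its lower row (c, d) satisfies (c i + d)^2 = i / v, and its upper row (a, b)
   satisfies a i + b = z (c i + d). *)
Definition frame (u : T1plane) : 'M[R]_2 :=
  let q := sqrtc ('i / (val u).2) in let p := (val u).1 * q in
  \matrix_(i, j) (if i == 0 then (if j == 0 then Im p else Re p)
                  else (if j == 0 then Im q else Re q)).

(* Both flows on T^1 H are the images of the model orbits through (i, i) by the
   isometry that moves (i, i) to u. *)
Definition geodesic_flowH t (u : T1plane) : T1plane :=
  dact (frame u) (vertical_geodesic t).
Definition horocyclic_flowH s (u : T1plane) : T1plane :=
  dact (frame u) (horizontal_horocycle s).

Lemma T1plane_neq0 (u : T1plane) : (val u).2 != 0.
Proof.
have [z0 nu] : unit_tangent_vectors (val u) by have /set_mem := valP u.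
by rewrite -sqnorm_gt0 nu exprn_gt0.
Qed.

Lemma det_frame (u : T1plane) : \det (frame u) = 1.
Proof.
have [z0 nu] : unit_tangent_vectors (val u) by have /set_mem := valP u.
rewrite det2 /frame !mxE /=; set q := sqrtc _.
have s1 : sqnorm q ^+ 2 = (Im (val u).1 ^+ 2)^-1.
  rewrite expr2 -sqnormM -expr2 sqr_sqrtc sqnormM sqnormV nu.
  by rewrite {1}/sqnorm /= expr0n expr1n add0r mul1r.
have {}s1 : sqnorm q = (Im (val u).1)^-1.
  apply/eqP; rewrite -(@eqrXn2 _ 2)//; first by rewrite s1 exprVn.
    by rewrite addr_ge0 ?sqr_ge0.
  by rewrite invr_ge0 ltW.
have : Im (val u).1 * sqnorm q = 1 by rewrite s1 divff// gt_eqF.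
case: (val u).1 {z0 nu s1} => x y; case: (q) => a b; rewrite /sqnorm /= => <-.
ring.
Qed.

Lemma frameP (u : T1plane) : dact (frame u) (vertical_geodesic 0) = u.
Proof.
have q0 : sqrtc ('i / (val u).2) != 0.
  rewrite sqrtc_eq0 mulf_neq0 ?invr_neq0 ?T1plane_neq0//.
  by rewrite eq_complex /= oner_eq0 andbF.
apply/val_inj; rewrite val_dact ?det_frame// /dmobius /mobius /= expR0.
set q := sqrtc _ in q0 *.
have -> : mobius_den (frame u) 'i = q.
  by rewrite /mobius_den !mxE -/q /=; case: (q) => a b; simpc.
have -> : mobius_num (frame u) 'i = (val u).1 * q.
  by rewrite /mobius_num !mxE -/q /=; move: (_.1 * q) => [a b]; simpc.
have i0 : 'i%C != 0 :> R[i] by rewrite eq_complex /= oner_eq0 andbF.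
rewrite mulfK// sqr_sqrtc invf_div mulrCA divff// mulr1.
by rewrite -surjective_pairing.
Qed.

Lemma frame_dact A (u : T1plane) : \det A = 1 ->
  frame (dact A u) = A * frame u \/ frame (dact A u) = - (A * frame u).
Proof.
move=> dA; pose z := (val u).1; pose q := sqrtc ('i / (val u).2).
pose q' := sqrtc ('i / (val (dact A u)).2).
have d0 : mobius_den A z != 0.
  by rewrite mobius_den_neq0//; have /set_mem [] := valP u.
have p'E : (val (dact A u)).1 * q' = mobius_num A z * (q' / mobius_den A z).
  by rewrite val_dact// -mulrA (mulrC q').
have : q' ^+ 2 = (mobius_den A z * q) ^+ 2.
  rewrite exprMn !sqr_sqrtc val_dact// [(dmobius _ _).2]/= invf_div.
  by rewrite mulrCA.
have ReZ (a : R) w : Re (a%:C * w) = a * Re w by case: w => ? ?; simpc.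
have ImZ (a : R) w : Im (a%:C * w) = a * Im w by case: w => ? ?; simpc.
have ReD w1 w2 : Re (w1 + w2) = Re w1 + Re w2 by case: w1 w2 => ? ? [].
have ImD w1 w2 : Im (w1 + w2) = Im w1 + Im w2 by case: w1 w2 => ? ? [].
have ReN w : Re (- w) = - Re w by case: w.
have ImN w : Im (- w) = - Im w by case: w.
have numE : mobius_num A z * q = (A 0 0)%:C * (z * q) + (A 0 1)%:C * q.
  by rewrite mulrDl mulrA.
have denE : mobius_den A z * q = (A 1 0)%:C * (z * q) + (A 1 1)%:C * q.
  by rewrite mulrDl mulrA.
have i01 (i : 'I_2) : i = 0 \/ i = 1.
  by case: i => [[|[]]]// ?; [left|right]; exact/val_inj.
have l01 : lift 0 0 = 1 :> 'I_2 by exact/val_inj.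
move=> /eqP; rewrite eqf_sqr => /orP[] /eqP qE; [left|right].
- have {}p'E : (val (dact A u)).1 * q' = mobius_num A z * q.
    by rewrite p'E qE mulrAC divff// mul1r.
  apply/matrixP => i j; rewrite !mxE !big_ord_recl big_ord0 addr0 l01 !mxE.
  rewrite -/q -/q' -/z p'E qE numE denE.
  by have [->|->] := i01 i; have [->|->] := i01 j; rewrite /= ?(ReD, ImD, ReZ, ImZ).
- have {}p'E : (val (dact A u)).1 * q' = - (mobius_num A z * q).
    by rewrite p'E qE mulNr mulrN mulrAC divff// mul1r.
  apply/matrixP => i j; rewrite !mxE !big_ord_recl big_ord0 addr0 l01 !mxE.
  rewrite -/q -/q' -/z p'E qE numE denE.
  by have [->|->] := i01 i; have [->|->] := i01 j;
    rewrite /= ?(ReN, ImN) ?(ReD, ImD) ?(ReZ, ImZ).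
Qed.

Lemma geodesic_flowH_dact A t (u : T1plane) : \det A = 1 ->
  geodesic_flowH t (dact A u) = dact A (geodesic_flowH t u).
Proof.
move=> dA; rewrite /geodesic_flowH.
by have [->|->] := frame_dact u dA; rewrite ?dactN dactM ?det_frame.
Qed.

Lemma horocyclic_flowH_dact A s (u : T1plane) : \det A = 1 ->
  horocyclic_flowH s (dact A u) = dact A (horocyclic_flowH s u).
Proof.
move=> dA; rewrite /horocyclic_flowH.
by have [->|->] := frame_dact u dA; rewrite ?dactN dactM ?det_frame.
Qed.

Lemma hdist_act A (z w : plane) : \det A = 1 ->
  hdist (act A z) (act A w) = hdist z w.
Proof.
move=> dA.
have z0 : 0 < Im (val z) by have /set_mem := valP z.
have w0 : 0 < Im (val w) by have /set_mem := valP w.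
have dz := mobius_den_neq0 dA z0; have dw := mobius_den_neq0 dA w0.
rewrite /hdist !val_act// !Im_mobius//; congr (acosh (1 + _)).
have -> : mobius A (val z) - mobius A (val w) =
    (val z - val w) / (mobius_den A (val z) * mobius_den A (val w)).
  rewrite /mobius -mulNr addf_div//; congr (_ / _).
  have dC : (A 0 0)%:C * (A 1 1)%:C - (A 0 1)%:C * (A 1 0)%:C = 1 :> R[i].
    by rewrite -!rmorphM -rmorphB -det2 dA rmorph1.
  rewrite -[RHS]mul1r -dC /mobius_num /mobius_den.
  move: (val z) (val w) => a b; ring.
rewrite sqnormM sqnormV sqnormM.
have sz : sqnorm (mobius_den A (val z)) != 0 by rewrite gt_eqF// sqnorm_gt0.
have sw : sqnorm (mobius_den A (val w)) != 0 by rewrite gt_eqF// sqnorm_gt0.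
move: (sqnorm (mobius_den A (val z))) (sqnorm (mobius_den A (val w))) sz sw.
move: (sqnorm _) (Im (val z)) (Im (val w)) z0 w0 => n x y x0 y0 a b a0 b0.
by field; rewrite a0 b0 !gt_eqF.
Qed.

End HyperbolicPlane.

(* A subgroup of PSL(2, R) is encoded by its full preimage in SL(2, R), which
   contains -1. *)
Record fuchsian_group (R : realType) := FuchsianGroup {
  fuchsian_set :> 'M[R]_2 -> Prop;
  fuchsian_det : forall A, fuchsian_set A -> \det A = 1;
  fuchsian1 : fuchsian_set 1;
  fuchsianN1 : fuchsian_set (-1);
  fuchsianM : forall A B, fuchsian_set A -> fuchsian_set B -> fuchsian_set (A * B);
  fuchsianV : forall A, fuchsian_set A -> fuchsian_set A^-1;
  fuchsian_discrete : forall A, fuchsian_set A ->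
    isolated (fuchsian_set : set 'M[R]_2) A }.

Section HyperbolicSurfaces.
Variable R : realType.
Implicit Types (G : fuchsian_group R).

(* The nontrivial elements of PSL(2, R). *)
Definition nontrivial (A : 'M[R]_2) : Prop := A != 1 /\ A != -1.

Definition elliptic (A : 'M[R]_2) : Prop :=
  nontrivial A /\ exists z : plane R, act A z = z.

Record hyperbolic_surface := HyperbolicSurface {
  surface_group :> fuchsian_group R;
  no_elliptic : forall A, fuchsian_set surface_group A -> ~ elliptic A }.

Definition orbit_rel G (z w : plane R) : bool :=
  `[< exists2 A, G A & act A z = w >].
Definition T1orbit_rel G (u v : T1plane R) : bool :=
  `[< exists2 A, G A & dact A u = v >].

Lemma orbit_rel_equiv G : equiv_class_of (orbit_rel G).
Proof.
split=> [z|z w|w z y].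
- by apply/asboolP; exists 1; [exact: fuchsian1|exact: act1].
- have sym x y : orbit_rel G x y -> orbit_rel G y x.
    move=> /asboolP[A GA <-]; apply/asboolP; exists A^-1; first exact: fuchsianV.
    have dA := fuchsian_det GA.
    by rewrite -actM ?det_inv ?dA ?invr1// mulVr ?act1// unitmxE dA unitr1.
  by apply/idP/idP; exact: sym.
- move=> /asboolP[A GA <-] /asboolP[B GB <-]; apply/asboolP.
  exists (B * A); first exact: fuchsianM.
  by rewrite actM ?(fuchsian_det GA) ?(fuchsian_det GB).
Qed.

Lemma T1orbit_rel_equiv G : equiv_class_of (T1orbit_rel G).
Proof.
split=> [z|z w|w z y].
- by apply/asboolP; exists 1; [exact: fuchsian1|exact: dact1].
- have sym x y : T1orbit_rel G x y -> T1orbit_rel G y x.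
    move=> /asboolP[A GA <-]; apply/asboolP; exists A^-1; first exact: fuchsianV.
    have dA := fuchsian_det GA.
    by rewrite -dactM ?det_inv ?dA ?invr1// mulVr ?dact1// unitmxE dA unitr1.
  by apply/idP/idP; exact: sym.
- move=> /asboolP[A GA <-] /asboolP[B GB <-]; apply/asboolP.
  exists (B * A); first exact: fuchsianM.
  by rewrite dactM ?(fuchsian_det GA) ?(fuchsian_det GB).
Qed.

Canonical orbit_equiv_rel G := EquivRelPack (orbit_rel_equiv G).
Canonical T1orbit_equiv_rel G := EquivRelPack (T1orbit_rel_equiv G).

Implicit Type S : hyperbolic_surface.

Definition surface S : Type :=
  quotient_topology {eq_quot (orbit_equiv_rel S)}.
HB.instance Definition _ S := Topological.on (surface S).
HB.instance Definition _ S := Quotient.on (surface S).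

Definition T1surface S : Type :=
  quotient_topology {eq_quot (T1orbit_equiv_rel S)}.
HB.instance Definition _ S := Topological.on (T1surface S).
HB.instance Definition _ S := Quotient.on (T1surface S).

Definition dirichlet_domain S (z0 : plane R) : set (plane R) :=
  [set z | forall A, S A -> hdist z z0 <= hdist z (act A z0)].

Definition half_plane (pq : plane R * plane R) : set (plane R) :=
  [set z | hdist z pq.1 <= hdist z pq.2].

(* A finite-sided convex polygon is a finite intersection of half-planes. *)
Definition finite_sided (D : set (plane R)) : Prop :=
  exists s : seq (plane R * plane R),
    all (fun pq => pq.1 != pq.2) s /\
    D = [set z | forall pq, pq \in s -> half_plane pq z].

Definition geometrically_finite S : Prop :=
  exists z0 : plane R, finite_sided (dirichlet_domain S z0).

Definition geometrically_infinite S : Prop := ~ geometrically_finite S.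

(* The flows, foot and Inj do not depend on the representative: see the lemmas
   geodesic_flow_pi, horocyclic_flow_pi, foot_pi and Inj_pi. *)
Definition geodesic_flow S (t : R) (u : T1surface S) : T1surface S :=
  \pi_(T1surface S) (geodesic_flowH t (repr u)).
Definition horocyclic_flow S (s : R) (u : T1surface S) : T1surface S :=
  \pi_(T1surface S) (horocyclic_flowH s (repr u)).

Definition foot S (u : T1surface S) : surface S :=
  \pi_(surface S) (base_point (repr u)).

Definition horocyclic_orbit S (u : T1surface S) : set (T1surface S) :=
  [set horocyclic_flow s u | s in setT].

(* Only s > T is considered: h_s U meets U if and only if h_{-s} U does. *)
Definition nonwandering S : set (T1surface S) :=
  [set u | forall U, nbhs u U -> forall T : R,
    exists2 s, T < s & (horocyclic_flow s @` U) `&` U !=set0].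

Definition irregular_orbit S (u : T1surface S) : Prop :=
  [/\ nonwandering u, ~ closed (horocyclic_orbit u)
    & ~ (@nonwandering S `<=` closure (horocyclic_orbit u))].

Definition horocyclic_invariant S (M : set (T1surface S)) : Prop :=
  forall s u, M u -> M (horocyclic_flow s u).

Definition horocyclic_minimal S (M : set (T1surface S)) : Prop :=
  [/\ M !=set0, closed M, horocyclic_invariant M
    & forall F, F !=set0 -> closed F -> horocyclic_invariant F ->
        F `<=` M -> F = M].

Definition Inj S (x : surface S) : \bar R :=
  ereal_inf [set (hdist (repr x) (act A (repr x)))%:E
            | A in [set A | S A /\ nontrivial A]].

Definition geodesic_ray S (u : T1surface S) (t : R) : surface S :=
  foot (geodesic_flow t u).

Definition asymptotic_fineness S (u : T1surface S) : \bar R :=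
  limf_einf (fun t => Inj (geodesic_ray u t)) (pinfty_nbhs R).

Definition return_times S (u : T1surface S) : set R :=
  [set t | t != 0 /\ closure (horocyclic_orbit u) (geodesic_flow t u)].

Lemma T1surface_eqP S (u v : T1plane R) :
  \pi_(T1surface S) u = \pi_(T1surface S) v <-> exists2 A, S A & dact A u = v.
Proof.
split=> [/eqmodP/asboolP//|?].
by apply/eqmodP/asboolP.
Qed.

Lemma surface_eqP S (z w : plane R) :
  \pi_(surface S) z = \pi_(surface S) w <-> exists2 A, S A & act A z = w.
Proof.
split=> [/eqmodP/asboolP//|?].
by apply/eqmodP/asboolP.
Qed.

Lemma geodesic_flow_pi S t (u : T1plane R) :
  geodesic_flow t (\pi_(T1surface S) u) =
  \pi_(T1surface S) (geodesic_flowH t u).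
Proof.
have [A SA uE] := (T1surface_eqP S _ u).1 (reprK (\pi_(T1surface S) u)).
apply/T1surface_eqP; exists A => //.
by rewrite -geodesic_flowH_dact ?uE//; exact: fuchsian_det SA.
Qed.

Lemma horocyclic_flow_pi S s (u : T1plane R) :
  horocyclic_flow s (\pi_(T1surface S) u) =
  \pi_(T1surface S) (horocyclic_flowH s u).
Proof.
have [A SA uE] := (T1surface_eqP S _ u).1 (reprK (\pi_(T1surface S) u)).
apply/T1surface_eqP; exists A => //.
by rewrite -horocyclic_flowH_dact ?uE//; exact: fuchsian_det SA.
Qed.

Lemma foot_pi S (u : T1plane R) :
  foot (\pi_(T1surface S) u) = \pi_(surface S) (base_point u).
Proof.
have [A SA uE] := (T1surface_eqP S _ u).1 (reprK (\pi_(T1surface S) u)).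
apply/surface_eqP; exists A => //; have dA := fuchsian_det SA.
move: (repr _) uE => v <-; apply/val_inj.
by rewrite (val_act _ dA) !val_base_point (val_dact _ dA).
Qed.

Lemma nontrivial_conj (A B : 'M[R]_2) : \det B = 1 -> nontrivial A ->
  nontrivial (B * A * B^-1).
Proof.
move=> dB; have uB : B \is a GRing.unit by rewrite unitmxE dB unitr1.
have cB C : B * A * B^-1 = C -> A = B^-1 * C * B.
  by move=> <-; rewrite -!mulrA mulVr// mulr1 mulrA mulVr// mul1r.
move=> [/eqP A1 /eqP AN1]; split; apply/eqP => /cB AE.
  by apply: A1; rewrite AE mulr1 mulVr.
by apply: AN1; rewrite AE mulrN1 mulNr mulVr.
Qed.

Lemma Inj_pi S (z : plane R) : Inj (\pi_(surface S) z) =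
  ereal_inf [set (hdist z (act A z))%:E | A in [set A | S A /\ nontrivial A]].
Proof.
have sub x B : S B ->
    [set (hdist x (act A x))%:E | A in [set A | S A /\ nontrivial A]] `<=`
    [set (hdist (act B x) (act A (act B x)))%:E
      | A in [set A | S A /\ nontrivial A]].
  move=> SB _ [A [SA nA] <-]; have dB : \det B = 1 := fuchsian_det SB.
  have dA := fuchsian_det SA.
  have uB : B \is a GRing.unit by rewrite unitmxE dB unitr1.
  exists (B * A * B^-1).
    split; first by do 2?apply: fuchsianM => //; exact: fuchsianV.
    exact: nontrivial_conj.
  have dBA : \det (B * A * B^-1) = 1.
    by rewrite !det_mulmx det_inv dA dB mulr1 invr1 mulr1.
  have -> : act (B * A * B^-1) (act B x) = act B (act A x).
    by rewrite -(actM x dBA dB) -mulrA mulVr// mulr1 (actM x dB dA).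
  by rewrite hdist_act.
have := (surface_eqP S _ z).1 (reprK (\pi_(surface S) z)).
rewrite /Inj; move: (repr _) => x [B SB <-].
congr ereal_inf; apply/seteqP; split; first exact: sub.
have dB : \det B = 1 by exact: fuchsian_det SB.
have uB : B \is a GRing.unit by rewrite unitmxE dB unitr1.
have := sub (act B x) B^-1 (fuchsianV SB).
have -> // : act B^-1 (act B x) = x.
by rewrite -actM ?det_inv ?dB ?invr1// mulVr// act1.
Qed.

End HyperbolicSurfaces.

(* Main.v *)
Require Import Defs.
From mathcomp Require Import all_boot all_order all_algebra.
From mathcomp Require polyrcf.
From mathcomp Require Import all_classical all_reals all_analysis.
From mathcomp Require Import generic_quotient complex ring lra.
Set Implicit Arguments.
Unset Strict Implicit.
Unset Printing Implicit Defensive.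
Import Order.TTheory GRing.Theory Num.Theory numFieldNormedType.Exports.
Local Open Scope classical_set_scope.
Local Open Scope ring_scope.
Local Notation Re := complex.Re.
Local Notation Im := complex.Im.
Local Open Scope complex_scope.
Local Open Scope quotient_scope.

(** The horocyclic flow is read off the linear action of the group on the plane.
    A unit vector is the image of the upward vector at [i] under a matrix [g] of
    SL(2, R), its horocycle is the first column of [g] up to sign, and the
    geodesic flow multiplies this column by [expR (t / 2)]. If [u0] is the
    vector with first column [e1 = (1, 0)], then the closure of its horocyclic
    orbit corresponds to the closure of the orbit of [e1] in the punctured
    plane.

    The group is a Schottky group on infinitely many generators
    [gamma_n = [3, - (3 D + 1) r; 1 / r, - D]], where [D = n + 9] and the scale
    [r] grows fast enough for the isometric circles to be disjoint
    ([radiusS], [hi_le_lo]). Three features of these matrices do all the work.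

    - [gamma_n e1 = (3, 1 / r)] tends to [3 e1]. Hence [3 ^ k e1] lies in the
      closure of the orbit of [e1] ([wmx_group_approx]), which yields the return
      times [2 k ln 3]. Moreover a generator of large index maps some column
      close to [e1] to another one, and this amounts to a long way along a
      horocycle, so that [u0] is nonwandering ([nonwandering_ell]).

    - Outside the annulus of its inverse every letter enlarges both coordinates
      ([gen_expand]). So the first coordinate is at least 1 in absolute value
      all along the orbit of [e1] ([wmx_group_fst]). The vectors all of whose
      lifts have a first coordinate at least [m] form a closed invariant set
      [horo_ge (m ^ 2)]; the case [m = 1] separates the closure from smaller
      nonwandering vectors, and the case [m = 3] cuts out a proper closed
      invariant subset of it ([irregular_u0], [not_minimal_u0]). The same growth
      shows that the group is discrete and, applied to powers, that it has no
      elliptic element.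

    - The diagonal entry [- D] tends to infinity with [n]. A matrix
      [[a, b; c, d]] moves the point [i y] by a distance whose hyperbolic cosine
      is [(a^2 + d^2 + b^2 / y^2 + c^2 y^2) / 2]. If the letter of a word that acts
      first has a large index then [a] or [d] is large, and otherwise [c] is
      bounded from below, so that this distance tends to infinity with [y]
      ([asymptotic_fineness_u0]).

    Geometric infiniteness holds because the surface has infinitely many
    funnels. The gap between the two annuli of [gamma_k] lies between the fixed
    points of [gamma_k], and each gap has a translate that touches the Dirichlet
    domain at infinity ([gap_ideal]). If the domain had finitely many sides, its
    points at infinity would form finitely many intervals, and two of these
    translates, belonging to different gaps, would lie in the same interval.
    There would then be a hyperbolic fixed point between them ([axis_between]),
    but such a point is never at infinity of a Dirichlet domain
    ([axis_not_ideal]). *)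

(** * Two by two matrices acting on vectors *)

Section Matrices.
Variable R : realType.
Implicit Types (A B : 'M[R]_2) (v : R * R).

Definition mx2 (a b c d : R) : 'M[R]_2 :=
  \matrix_(i, j) if i == 0 then (if j == 0 then a else b)
                 else (if j == 0 then c else d).

Lemma mx2E a b c d : [/\ mx2 a b c d 0 0 = a, mx2 a b c d 0 1 = b,
  mx2 a b c d 1 0 = c & mx2 a b c d 1 1 = d].
Proof. by split; rewrite mxE. Qed.

Lemma det_mx2 a b c d : \det (mx2 a b c d) = a * d - b * c.
Proof. by rewrite det2; have [-> -> -> ->] := mx2E a b c d. Qed.

Lemma mulmx2E A B i j : (A * B) i j = A i 0 * B 0 j + A i 1 * B 1 j.
Proof.
rewrite !mxE !big_ord_recl big_ord0 addr0.
by rewrite (_ : lift 0 0 = 1); last exact/val_inj.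
Qed.

Lemma mx2P A B : A 0 0 = B 0 0 -> A 0 1 = B 0 1 -> A 1 0 = B 1 0 ->
  A 1 1 = B 1 1 -> A = B.
Proof.
have i01 (i : 'I_2) : i = 0 \/ i = 1.
  by case: i => [[|[]]]// ?; [left|right]; exact/val_inj.
by move=> *; apply/matrixP => i j; have [->|->] := i01 i; have [->|->] := i01 j.
Qed.

Definition app A v : R * R :=
  (A 0 0 * v.1 + A 0 1 * v.2, A 1 0 * v.1 + A 1 1 * v.2).

Lemma appM A B v : app (A * B) v = app A (app B v).
Proof. by rewrite /app !mulmx2E /=; congr (_, _); ring. Qed.

Lemma app1 v : app 1 v = v.
Proof. by case: v => x y; rewrite /app !mxE /=; congr (_, _); ring. Qed.

Lemma appN A v : app (- A) v = (- (app A v).1, - (app A v).2).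
Proof. by rewrite /app !mxE /=; congr (_, _); ring. Qed.

End Matrices.

(** * Ping-pong *)

Section PingPong.
Variable R : realType.
Implicit Types (A B : 'M[R]_2) (v : R * R) (n : nat).

Definition shift n : R := n%:R + 9.

Fixpoint radius n : R := if n is m.+1 then 2 * shift m * radius m else 1.

Definition letter : Type := (nat * bool)%type.
Implicit Types (s : letter) (w : seq letter).

Definition linv s : letter := (s.1, ~~ s.2).

(** The letter [(n, true)] is the generator [gamma_n] and [(n, false)] is its
    inverse. In the slope [x / y] measured in units of the radius, [gamma_n] is
    the map that sends [t] to [3 - 1 / (t - D)], and its inverse sends [t] to
    [D - 1 / (t - 3)]. *)
Definition gen s : 'M[R]_2 :=
  let D := shift s.1 in let r := radius s.1 in
  if s.2 then mx2 3 (- ((3 * D + 1) * r)) r^-1 (- D)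
  else mx2 (- D) ((3 * D + 1) * r) (- r^-1) 3.

(** The bounds of the slopes that the letter [s] may produce: an annulus around
    3 for a generator, and one around [D] for its inverse, in units of the
    radius. Slopes are only compared in absolute value. *)
Definition lo s : R := if s.2 then radius s.1 else 3 / 4 * shift s.1 * radius s.1.
Definition hi s : R := if s.2 then 5 * radius s.1 else 2 * shift s.1 * radius s.1.

Definition inside s v : Prop :=
  lo s * `|v.2| <= `|v.1| /\ `|v.1| <= hi s * `|v.2|.
Definition outside s v : Prop :=
  `|v.1| <= lo s * `|v.2| \/ hi s * `|v.2| <= `|v.1|.

Lemma shift_ge9 n : 9 <= shift n.
Proof. by rewrite /shift lerDr. Qed.

Lemma radius_gt0 n : 0 < radius n.
Proof.
by elim: n => //= n IH; rewrite mulr_gt0// mulr_gt0//; have := shift_ge9 n; lra.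
Qed.

Lemma radiusS n : radius n.+1 = 2 * shift n * radius n. Proof. by []. Qed.

Lemma radius_le n m : (n <= m)%N -> radius n <= radius m.
Proof.
elim: m => [|m IH]; first by rewrite leqn0 => /eqP->.
rewrite leq_eqVlt => /predU1P[->//|/IH h]; apply: le_trans h _.
rewrite radiusS ler_peMl// ?ltW ?radius_gt0//; have := shift_ge9 m; lra.
Qed.

Lemma lo_gt0 s : 0 < lo s.
Proof.
rewrite /lo; have := radius_gt0 s.1; have := shift_ge9 s.1.
by case: ifP => // *; rewrite mulr_gt0// mulr_gt0//; lra.
Qed.

Lemma radius_le_lo s : radius s.1 <= lo s.
Proof.
rewrite /lo; have := radius_gt0 s.1; have := shift_ge9 s.1.
by case: ifP => // *; rewrite ler_peMl//; lra.
Qed.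

Lemma hi_le_radius s : hi s <= radius s.1.+1.
Proof.
rewrite radiusS /hi; have := radius_gt0 s.1; have := shift_ge9 s.1.
by case: ifP => // *; rewrite ler_wpM2r//; lra.
Qed.

Lemma lo_ge1 s : 1 <= lo s.
Proof. exact: le_trans (radius_le (leq0n s.1)) (radius_le_lo s). Qed.

(** The annuli of a generator and of its inverse fit in one shell
    between consecutive radii, hence all annuli are disjoint. *)
Lemma hi_le_lo s s' : s != s' -> hi s <= lo s' \/ hi s' <= lo s.
Proof.
case: (ltngtP s.1 s'.1) => [h _|h _|].
- left; apply: le_trans (hi_le_radius s) _.
  exact: le_trans (radius_le h) (radius_le_lo s').
- right; apply: le_trans (hi_le_radius s') _.
  exact: le_trans (radius_le h) (radius_le_lo s).
case: s s' => [n b] [m b'] /= ->; rewrite xpair_eqE eqxx /=.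
have := radius_gt0 m; have := shift_ge9 m; rewrite /hi /lo /=.
by case: b b' => -[] //= ? ?; [left|right]; rewrite ler_wpM2r//; lra.
Qed.

Lemma inside_outside s s' v : s != s' -> inside s v -> outside s' v.
Proof.
move=> /hi_le_lo[] h [h1 h2]; [left|right].
  by apply: le_trans h2 _; rewrite ler_wpM2r.
by apply: le_trans h1; rewrite ler_wpM2r.
Qed.

Lemma linvK : involutive linv.
Proof. by case=> n b; rewrite /linv /= negbK. Qed.

Lemma det_gen s : \det (gen s) = 1.
Proof.
have r0 : radius s.1 != 0 by rewrite gt_eqF ?radius_gt0.
by rewrite /gen; case: ifP => _; rewrite det_mx2; field.
Qed.

Lemma gen_linv s : gen (linv s) * gen s = 1.
Proof.
have r0 : radius s.1 != 0 by rewrite gt_eqF ?radius_gt0.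
apply: mx2P; rewrite mulmx2E /gen /linv /=; case: s.2 => /=; rewrite !mxE /=; field => //.
Qed.

(** The slope, in units of the radius, is at distance at least 2 from the pole
    of the Moebius map, whose isometric circle has radius 1. This doubles the
    second coordinate, and it leaves the image of the slope well inside the
    annulus; the first coordinate is controlled through the image slope. *)
Lemma gen_expand s v : outside (linv s) v ->
  [/\ `|v.1| <= `|(app (gen s) v).1|, 2 * `|v.2| <= `|(app (gen s) v).2|
    & inside s (app (gen s) v)].
Proof.
case: s v => n b [x0 y]; rewrite /outside /inside /linv /lo /hi /app /gen /=.
have := radius_gt0 n; have := shift_ge9 n.
move: (shift n) (radius n) => D r D9 r0.
(* All slopes are measured in units of the radius from here on. *)
have [x ->] : exists x, x0 = x * r by exists (x0 / r); rewrite mulfVK// gt_eqF.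
have rn : r != 0 by rewrite gt_eqF.
have Mr a c : (a * r * c) = a * c * r by rewrite mulrAC.
have rM c : r * c = c * r by rewrite mulrC.
have N1 : `|3 * D + 1| = 3 * D + 1 by rewrite ger0_norm//; lra.
have N2 : `|D| = D by rewrite ger0_norm//; lra.
have N3 (c : R) : `|3 * c| = 3 * `|c| by rewrite normrM ger0_norm.
have y0 : 0 <= `|y| by [].
have x00 : 0 <= `|x| by [].
case: b => /=; rewrite !mxE /=.
- rewrite (_ : 3 * (x * r) + _ = (3 * x - (3 * D + 1) * y) * r); last by ring.
  rewrite (_ : r^-1 * (x * r) + _ = x - D * y); last by field.
  have E : 3 * x - (3 * D + 1) * y = 3 * (x - D * y) - y by ring.
  have e1 := lerB_normD x (- (D * y)).
  have e2 := lerB_normD (D * y) (- x).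
  have e3 := lerB_normD (3 * x) (- ((3 * D + 1) * y)).
  have e4 := lerB_normD ((3 * D + 1) * y) (- (3 * x)).
  have e5 := lerB_normD (3 * (x - D * y)) (- y).
  have e6 := ler_normD (3 * (x - D * y)) (- y).
  rewrite -(normrN (_ + - x)) opprB in e2.
  rewrite -(normrN (_ + - (3 * x))) opprB in e4.
  rewrite E in e3 e4 *.
  rewrite ?normrN ?N3 ?(normrM _ y) ?N1 ?N2 in e1 e2 e3 e4 e5 e6.
  rewrite !normrM (gtr0_norm r0) -?normrM !Mr ?rM !(ler_pM2r r0).
  move: e1 e2 e3 e4 e5 e6 y0 x00.
  move: `|x| `|y| `|x - D * y| `|3 * (x - D * y) - y| => X Y Y' X'.
  move=> e1 e2 e3 e4 e5 e6 y0 x00.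
  have DY : 9 * Y <= D * Y by rewrite ler_wpM2r.
  by case=> h; split; try split; lra.
- rewrite (_ : - D * (x * r) + _ = ((3 * D + 1) * y - D * x) * r); last by ring.
  rewrite (_ : - r^-1 * (x * r) + _ = 3 * y - x); last by field.
  have E : (3 * D + 1) * y - D * x = D * (3 * y - x) + y by ring.
  have e1 := lerB_normD x (- (3 * y)).
  have e2 := lerB_normD (3 * y) (- x).
  have e3 := lerB_normD (D * x) (- ((3 * D + 1) * y)).
  have e4 := lerB_normD ((3 * D + 1) * y) (- (D * x)).
  have e5 := lerB_normD (D * (3 * y - x)) y.
  have e6 := ler_normD (D * (3 * y - x)) y.
  rewrite -(normrN (_ + - (3 * y))) opprB in e1.
  rewrite -(normrN (_ + - ((3 * D + 1) * y))) opprB in e3.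
  rewrite E in e3 e4 *.
  rewrite ?normrN ?N3 ?(normrM D) ?(normrM _ y) ?N1 ?N2 in e1 e2 e3 e4 e5 e6.
  rewrite !normrM (gtr0_norm r0) -?normrM !Mr ?rM !(ler_pM2r r0).
  move: e1 e2 e3 e4 e5 e6 y0 x00.
  move: `|x| `|y| `|3 * y - x| `|D * (3 * y - x) + y| => X Y Y' X'.
  move=> e1 e2 e3 e4 e5 e6 y0 x00.
  have DY : 9 * Y <= D * Y by rewrite ler_wpM2r.
  have DX : 9 * X <= D * X by rewrite ler_wpM2r.
  have h' : X <= Y \/ 5 * Y <= X -> D * X <= D * Y \/ D * (5 * Y) <= D * X.
    by case=> h; [left|right]; rewrite ler_wpM2l//; lra.
  have DY' : 9 * Y' <= D * Y' by rewrite ler_wpM2r//; lra.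
  by move=> h; case: h (h' h) => h0 [] h1; split; try split; lra.
Qed.

End PingPong.

(** * The group generated by the ping-pong matrices *)

Section Words.
Variable R : realType.
Implicit Types (A B : 'M[R]_2) (v : R * R) (n : nat) (s : letter) (w : seq letter).

Definition wmx w : 'M[R]_2 := \prod_(s <- w) gen R s.
Definition reduced w : bool := sorted (fun s t => t != linv s) w.

Lemma wmx_cons s w : wmx (s :: w) = gen R s * wmx w.
Proof. exact: big_cons. Qed.

Lemma wmx_cat w1 w2 : wmx (w1 ++ w2) = wmx w1 * wmx w2.
Proof. exact: big_cat. Qed.

Lemma wmx1 s : wmx [:: s] = gen R s.
Proof. exact: big_seq1. Qed.

Lemma reduced_cons s w : reduced (s :: w) -> reduced w.
Proof. exact: path_sorted. Qed.

(** Ping-pong: in a reduced word the image of each letter is outside the annulus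
    of the inverse of the next one, so that the growth accumulates. Only the
    last letter of the word, which acts first, constrains the vector. *)
Lemma word_expand w v : reduced w ->
  (forall s w', w = rcons w' s -> outside (linv s) v) ->
  [/\ `|v.1| <= `|(app (wmx w) v).1|,
      2 ^+ size w * `|v.2| <= `|(app (wmx w) v).2|
    & forall s w', w = s :: w' -> inside s (app (wmx w) v)].
Proof.
elim: w => [|s w IH] rw ov; first by rewrite /wmx big_nil app1 mul1r.
have [||h1 h2 h3] := IH; first exact: reduced_cons rw.
  by move=> t w' wE; apply: (ov t (s :: w')); rewrite wE.
have os : outside (linv s) (app (wmx w) v).
  case: w {IH} rw ov h3 {h1 h2} => [_ ov _|t w /= /andP[st _] _ h3].
    by rewrite /wmx big_nil app1; exact: (ov _ [::]).
  exact: inside_outside st (h3 _ _ erefl).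
rewrite wmx_cons appM; have [g1 g2 g3] := gen_expand os.
split; [exact: le_trans g1| |by move=> _ _ [<- _]].
by rewrite exprS -mulrA; apply: le_trans g2; rewrite ler_wpM2l.
Qed.

Lemma word_snd w v : reduced w ->
  (forall s w', w = rcons w' s -> outside (linv s) v) ->
  `|v.2| <= `|(app (wmx w) v).2|.
Proof.
move=> rw ov; have [_ h _] := word_expand rw ov; apply: le_trans h.
by rewrite ler_peMl// exprn_ege1// ler1n.
Qed.

(** A letter of large index cannot be compensated by the others, so that only
    finitely many words keep a given vector bounded. *)
Lemma word_letter_le w v s : reduced w -> (forall s, outside s v) -> s \in w ->
  radius R s.1 * `|v.2| <= `|(app (wmx w) v).1|.
Proof.
move=> + ov; elim: w => // t w IH rtw.
have [_ h1 /(_ _ _ erefl)[h2 _]] := word_expand rtw (fun s _ _ => ov (linv s)).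
rewrite inE => /predU1P[->|sw].
  apply: le_trans h2; apply: ler_pM => //; first by rewrite ltW// radius_gt0.
    exact: radius_le_lo.
  by apply: word_snd rtw _ => *; exact: ov.
apply: le_trans (IH (reduced_cons rtw) sw) _.
rewrite wmx_cons appM; have [|//] := @gen_expand R t (app (wmx w) v).
have [_ _ h3] := word_expand (reduced_cons rtw) (fun s _ _ => ov (linv s)).
case: w {IH h1 h2} sw rtw h3 => // u w _ /= /andP[ut _] h3.
exact: inside_outside ut (h3 _ _ erefl).
Qed.

Lemma outside_e1 s : outside s ((1, 0) : R * R).
Proof. by right; rewrite /= normr0 mulr0. Qed.

Lemma outside_e2 s : outside s ((0, 1) : R * R).
Proof. by left; rewrite /= normr0 normr1 mulr1 ltW ?lo_gt0. Qed.

Lemma app_e1 A : app A (1, 0) = (A 0 0, A 1 0).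
Proof. by rewrite /app /= !mulr1 !mulr0 !addr0. Qed.

Lemma app_e2 A : app A (0, 1) = (A 0 1, A 1 1).
Proof. by rewrite /app /= !mulr1 !mulr0 !add0r. Qed.

Lemma det_wmx w : \det (wmx w) = 1.
Proof.
elim: w => [|s w IH]; first by rewrite /wmx big_nil det1.
by rewrite wmx_cons det_mulmx det_gen IH mulr1.
Qed.

Lemma reduce_word w : exists2 w', reduced w' & wmx w = wmx w'.
Proof.
elim: w => [|s w [w' rw' E]]; first by exists [::].
rewrite wmx_cons E; case: w' rw' {E} => [_|t w' rw'].
  by exists [:: s]; rewrite // wmx1 /wmx big_nil mulr1.
have [ts|ts] := eqVneq t (linv s); last first.
  by exists (s :: t :: w'); rewrite ?wmx_cons//=; rewrite /= ts.
exists w'; first exact: reduced_cons rw'.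
by rewrite wmx_cons mulrA ts -{1}(linvK s) gen_linv mul1r.
Qed.

(** The sign makes this the full preimage in SL(2, R) of a subgroup of
    PSL(2, R). *)
Definition wmx_group A : Prop :=
  exists2 w, reduced w & A = wmx w \/ A = - wmx w.

Lemma wmx_group_word w : wmx_group (wmx w).
Proof. by have [w' rw' ->] := reduce_word w; exists w' => //; left. Qed.

Lemma wmx_groupN A : wmx_group A -> wmx_group (- A).
Proof. by move=> [w rw [->|->]]; exists w => //; rewrite ?opprK; [right|left]. Qed.

Lemma wmx_group1 : wmx_group 1.
Proof. by have := wmx_group_word [::]; rewrite /wmx big_nil. Qed.

Lemma wmx_groupM A B : wmx_group A -> wmx_group B -> wmx_group (A * B).
Proof.
have AB w w' : wmx_group (wmx w * wmx w') by rewrite -wmx_cat; exact: wmx_group_word.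
by move=> [w _ [->|->]] [w' _ [->|->]]; rewrite ?mulNr ?mulrN ?opprK//;
  exact: wmx_groupN.
Qed.

Lemma wmx_linv w : wmx (rev (map linv w)) * wmx w = 1.
Proof.
elim: w => [|s w IH]; first by rewrite /wmx !big_nil mulr1.
by rewrite wmx_cons /= rev_cons -cats1 wmx_cat wmx1 -mulrA (mulrA (gen _ _)) gen_linv mul1r.
Qed.

Lemma wmx_groupV A : wmx_group A -> wmx_group A^-1.
Proof.
have wV w : (wmx w)^-1 = wmx (rev (map linv w)).
  by rewrite -[LHS]mul1r -(wmx_linv w) mulrK// unitmxE det_wmx unitr1.
by move=> [w _ [->|->]]; rewrite ?invrN wV; first exact: wmx_group_word;
  apply: wmx_groupN; exact: wmx_group_word.
Qed.

Lemma wmx_group_det A : wmx_group A -> \det A = 1.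
Proof. by move=> [w _ [->|->]]; rewrite ?det2 ?mxE ?mulrNN -?det2 det_wmx. Qed.

(** The second column of a nontrivial word points into one of the annuli, all
    of which avoid the vertical direction. *)
Lemma wmx_group_small A : wmx_group A -> `|A 0 1| < A 1 1 -> A = 1.
Proof.
move=> [[|s w] rw AE]; first by case: AE => ->; rewrite /wmx big_nil//
  !mxE /= oppr0 normr0 oppr_gt0 ltr10.
have [_ _ /(_ _ _ erefl)[h _]] :=
  word_expand rw (fun s _ _ => outside_e2 (linv s)).
have {}h : `|A 1 1| <= `|A 0 1|.
  apply: le_trans (_ : lo R s * `|A 1 1| <= _); first by rewrite ler_peMl// lo_ge1.
  by move: h; rewrite app_e2; case: AE => ->; rewrite // !mxE !normrN.
by move=> h1; have := le_lt_trans h h1; rewrite ltNge ler_norm.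
Qed.

Lemma wmx_group_discrete A : wmx_group A -> isolated (wmx_group : set 'M[R]_2) A.
Proof.
move=> GA; split; first exact/mem_set.
have dA := wmx_group_det GA.
have uA : A \is a GRing.unit by rewrite unitmxE dA unitr1.
pose f (B : 'M[R]_2) := (A^-1 * B) 1 1 - `|(A^-1 * B) 0 1|.
have cf : continuous f.
  have -> : f = fun B => A^-1 1 0 * B 0 1 + A^-1 1 1 * B 1 1
                      - `|A^-1 0 0 * B 0 1 + A^-1 0 1 * B 1 1|.
    by apply/funext => B; rewrite /f !mulmx2E.
  move=> B.
  have cc i j a : (fun M : 'M[R]_2 => a * M i j) @ B --> a * B i j.
    by have h := @coord_continuous R 2 2 i j B; exact: (cvgMl_tmp h).
  exact: (cvgB (cvgD (cc _ _ _) (cc _ _ _)) (cvg_norm (cvgD (cc _ _ _) (cc _ _ _)))).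
exists (f @^-1` [set x | 0 < x]).
  apply: (cf A); apply: open_nbhs_nbhs; split; first exact: open_gt.
  by rewrite /f /= mulVr// !mxE /= normr0 subr0.
apply/seteqP; split=> [B [/= f0 GB]|_ ->]; last first.
  by split=> //; rewrite /f /= mulVr// !mxE /= normr0 subr0.
have := wmx_group_small (wmx_groupM (wmx_groupV GA) GB).
move: f0; rewrite /f subr_gt0 => f0 /(_ f0) E.
by rewrite /= -[LHS]mul1r -(mulrV uA) -mulrA E mulr1.
Qed.

Definition wmx_fuchsian : fuchsian_group R := FuchsianGroup wmx_group_det
  wmx_group1 (wmx_groupN wmx_group1) wmx_groupM wmx_groupV wmx_group_discrete.

End Words.

(** * Absence of elliptic elements *)

Section NoElliptic.
Variable R : realType.
Implicit Types (A B : 'M[R]_2) (z : plane R) (s : letter) (w : seq letter).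

Lemma plane_gt0 z : 0 < Im (val z).
Proof. exact: (set_mem (valP z)). Qed.

(** The lower row of the stabilizer of a point is bounded: the denominator of
    the Moebius map has modulus 1 there. *)
Lemma fixed_point_bound A z : \det A = 1 -> act A z = z ->
  `|A 1 1| <= 1 + `|Re (val z)| / Im (val z).
Proof.
move=> dA /(congr1 val); rewrite val_act// => /(congr1 (@complex.Im _)).
have z0 := plane_gt0 z; rewrite Im_mobius//.
case: (val z) z0 => x y /= y0 E.
have s0 : 0 < sqnorm (mobius_den A (x +i* y)) by rewrite sqnorm_gt0 mobius_den_neq0.
have : sqnorm (mobius_den A (x +i* y)) = 1.
  by apply: (mulfI (lt0r_neq0 y0)); rewrite -{1}E mulfVK ?gt_eqF// mulr1.
rewrite /sqnorm /mobius_den /= => {s0}E1.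
have le1 (a b : R) : a ^+ 2 + b ^+ 2 = 1 -> `|a| <= 1.
  by move=> ab; rewrite -[leRHS]normr1 -ler_sqr ?nnegrE// !real_normK ?num_real//; have := sqr_ge0 b; nra.
have h1 : `|A 1 0 * x + A 1 1| <= 1.
  by apply: (le1 _ (A 1 0 * y)); rewrite -E1; ring.
have h2 : `|A 1 0| * y <= 1.
  rewrite -{1}(gtr0_norm y0) -normrM.
  by apply: (le1 _ (A 1 0 * x + A 1 1)); rewrite -E1; ring.
rewrite (_ : A 1 1 = (A 1 0 * x + A 1 1) - A 1 0 * x); last by ring.
apply: le_trans (ler_normB _ _) _; apply: lerD h1 _.
by rewrite normrM mulrC ler_wpM2l// -[leRHS]mul1r ler_pdivlMr.
Qed.

(** The lower right entry of the powers of a cyclically reduced word grows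
    exponentially, while it stays bounded in the stabilizer of a point; other
    words are conjugate to shorter ones. *)
Lemma word_fixed_point_free w z : reduced w -> w != [::] -> act (wmx R w) z <> z.
Proof.
have [n] := ubnP (size w); elim: n w z => // n IH [//|s w] z.
rewrite ltnS => wn rw _ fz.
have [ls|/negPn/eqP ls] := boolP (s != linv (last s w)); last first.
  case/lastP: w ls wn rw fz => [|w t]; first by case: s => m b [] /=; case: b.
  rewrite /reduced /= last_rcons size_rcons rcons_path => -> wn /andP[pw tw] fz.
  have E : gen R t * wmx R (linv t :: rcons w t) = wmx R w * gen R t.
    rewrite wmx_cons -cats1 wmx_cat wmx1 !mulrA.
    by have := gen_linv R (linv t); rewrite linvK => ->; rewrite mul1r.
  apply: (IH w (act (gen R t) z)); first exact: ltnW.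
  - exact: path_sorted pw.
  - by apply/eqP => w0; move: tw; rewrite w0 /= linvK eqxx.
  - by rewrite -actM ?det_wmx ?det_gen// -E actM ?det_wmx ?det_gen// fz.
(* A cyclically reduced word has reduced powers. *)
pose pw k := iter k (cat (s :: w)) [::].
have rpw k : path (fun s t => t != linv s) (last s w) (pw k).
  by elim: k => //= k IHk; rewrite ls cat_path IHk andbT.
have spw k : (k <= size (pw k))%N.
  elim: k => //= k IHk; rewrite ltnS size_cat.
  exact: leq_trans IHk (leq_addl _ _).
have fpw k : act (wmx R (pw k)) z = z.
  elim: k => [|k IHk]; first by rewrite /pw /wmx /= big_nil act1.
  by rewrite /pw iterS wmx_cat actM ?det_wmx// -/(pw k) IHk.
pose C := 1 + `|Re (val z)| / Im (val z).
have Ck k : k%:R <= C.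
  have := fixed_point_bound (det_wmx R _) (fpw k); rewrite -/C; apply: le_trans.
  have [_ + _] := word_expand (path_sorted (rpw k)) (fun t _ _ => outside_e2 R (linv t)).
  rewrite app_e2 /= normr1 mulr1; apply: le_trans; rewrite -natrX ler_nat.
  exact: leq_trans (spw k) (ltnW (ltn_expl _ _)).
have := Ck (Num.truncn C).+1; rewrite leNgt => /negP; apply.
by rewrite -truncn_lt_nat ?ltnS//; exact: le_trans (Ck 0%N).
Qed.

Lemma wmx_group_no_elliptic A : wmx_group A -> ~ elliptic A.
Proof.
move=> GA [[A1 AN1] [z fz]]; case: GA => w rw AE.
have w0 : w != [::].
  by apply/eqP => w0; case: AE A1 AN1; rewrite w0 /wmx big_nil => -> /eqP + /eqP.
apply: (@word_fixed_point_free w z rw w0); case: AE fz => -> //.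
by rewrite /act mobiusN.
Qed.

Definition wmx_surface : hyperbolic_surface R :=
  HyperbolicSurface (surface_group := wmx_fuchsian R) wmx_group_no_elliptic.

(** The index [n] is that of the letter that acts first, and both bounds persist
    under the following letters by ping-pong on [e1] and [e2]. The two cases
    correspond to a generator and to the inverse of a generator. *)
Lemma wmx_group_entries A : wmx_group A -> nontrivial A ->
  exists n, (radius R n)^-1 <= `|A 1 0| /\
    (shift R n <= `|A 0 0| \/ shift R n <= `|A 1 1|).
Proof.
move=> [w rw AE] [A1 AN1].
have {A1 AN1} w0 : w <> [::].
  by move=> w0; case: AE A1 AN1; rewrite w0 /wmx big_nil => -> /eqP + /eqP.
have nA i j : `|A i j| = `|wmx R w i j|.
  by case: AE => ->//; rewrite mxE normrN.
rewrite !nA => {A AE nA}.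
case/lastP: w w0 rw => // w s _ rw; exists s.1.
have rw' : reduced w by move: rw; rewrite /reduced -cats1 => /cat_sorted2[].
have start v : (forall s, outside s v) ->
    (`|(app (gen R s) v).1| <= `|(app (wmx R (rcons w s)) v).1|) /\
    (`|(app (gen R s) v).2| <= `|(app (wmx R (rcons w s)) v).2|).
  move=> ov; have [_ _ gi] := gen_expand (ov (linv s)).
  rewrite -cats1 wmx_cat wmx1 appM.
  have os t w' : w = rcons w' t -> outside (linv t) (app (gen R s) v).
    move=> wE; apply: inside_outside gi.
    move: rw; rewrite wE /reduced -cats1 -cats1 -catA /= => /cat_sorted2[_] /=.
    by rewrite andbT.
  by split; [have [h _ _] := word_expand rw' os|exact: word_snd os].
have := start _ (outside_e1 R); have := start _ (outside_e2 R).
rewrite !app_e1 !app_e2 /gen /= => -[_ h1] [h2 h3].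
have D0 : 0 < shift R s.1 by have := shift_ge9 R s.1; lra.
have r0 := radius_gt0 R s.1.
split; first by apply: le_trans h3; case: s.2;
  rewrite !mxE /= ?normrN gtr0_norm ?invr_gt0.
case: s.2 h1 h2 => + +; rewrite !mxE /= ?normrN !(gtr0_norm D0) => h1 h2.
  by right.
by left.
Qed.

Lemma wmx_group_fst A : wmx_group A -> 1 <= `|A 0 0|.
Proof.
move=> [w rw AE].
have [+ _ _] := word_expand rw (fun t _ _ => outside_e1 R (linv t)).
by rewrite app_e1 /= normr1; case: AE => ->//; rewrite mxE normrN.
Qed.

End NoElliptic.

(** * Unit tangent vectors in terms of matrices *)

Section Frames.
Variable R : realType.
Implicit Types (g A B : 'M[R]_2) (z : plane R) (u : T1plane R) (a b s t : R).

Definition base : T1plane R := vertical_geodesic 0.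

Lemma dact_base_coords g : \det g = 1 ->
  let n := g 1 0 ^+ 2 + g 1 1 ^+ 2 in
  n != 0 /\ val (dact g base) =
    (((g 0 0 * g 1 0 + g 0 1 * g 1 1) / n +i* n^-1),
     (2 * g 1 0 * g 1 1 / n ^+ 2 +i* ((g 1 1 ^+ 2 - g 1 0 ^+ 2) / n ^+ 2))).
Proof.
move=> dg /=; have n0 : g 1 0 ^+ 2 + g 1 1 ^+ 2 != 0.
  apply/eqP => /eqP; rewrite paddr_eq0 ?sqr_ge0// !expf_eq0 /= => /andP[/eqP c0 /eqP d0].
  by move: dg; rewrite det2 c0 d0 !mulr0 subrr => /eqP; rewrite eq_sym oner_eq0.
split=> //; rewrite val_dact// /dmobius /= expR0.
have d0 := mobius_den_neq0 dg (ltr01 : 0 < Im (0 +i* 1 : R[i])).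
have numE : mobius_num g (0 +i* 1) = g 0 1 +i* g 0 0.
  by rewrite /mobius_num; simpc.
have denE : mobius_den g (0 +i* 1) = g 1 1 +i* g 1 0.
  by rewrite /mobius_den; simpc.
congr (_, _).
  rewrite /mobius numE denE -[RHS](mulfK d0) denE; congr (_ / _).
  have {2}-> : (g 1 0 ^+ 2 + g 1 1 ^+ 2)^-1 =
      (g 0 0 * g 1 1 - g 0 1 * g 1 0) / (g 1 0 ^+ 2 + g 1 1 ^+ 2).
    by rewrite -det2 dg mul1r.
  by apply/eqP; rewrite eq_complex /=; apply/andP; split; apply/eqP; field.
rewrite denE -[RHS](mulfK (expf_neq0 2 d0)) denE; congr (_ / _).
by apply/eqP; rewrite eq_complex /=; apply/andP; split; apply/eqP; field.
Qed.

(** The square of the linear form [(a, b)] on the first column of a matrix that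
    produces [u] (see [horo_form_dact]), written in the coordinates of [u] in
    order to make its continuity apparent. *)
Definition horo_form a b (u : T1plane R) : R :=
  let x := Re (val u).1 in let y := Im (val u).1 in
  let p := Re (val u).2 in let q := Im (val u).2 in
  (((a * x + b) ^+ 2 + (a * y) ^+ 2) / y
   - (((a * x + b) ^+ 2 - (a * y) ^+ 2) * q - 2 * (a * x + b) * (a * y) * p)
     / y ^+ 2) / 2.

Lemma horo_form_dact a b g : \det g = 1 ->
  horo_form a b (dact g base) = (a * g 0 0 + b * g 1 0) ^+ 2.
Proof.
move=> dg; have [n0 E] := dact_base_coords dg; rewrite /horo_form E /=.
move: n0; set n := _ + _ => n0.
pose r := a * g 0 0 + b * g 1 0; pose r' := a * g 0 1 + b * g 1 1.
have -> : a * ((g 0 0 * g 1 0 + g 0 1 * g 1 1) / n) + b = (r * g 1 0 + r' * g 1 1) / n.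
  by rewrite /r /r' /n; field.
have -> : a * n^-1 = (r * g 1 1 - r' * g 1 0) / n.
  by rewrite -[a in LHS]mulr1 -dg det2 /r /r'; field.
by rewrite -/r; rewrite /n in n0 *; field.
Qed.

Lemma T1plane_dact u : exists2 g, \det g = 1 & u = dact g base.
Proof. by exists (frame u); rewrite ?det_frame// frameP. Qed.

Definition unipotent s : 'M[R]_2 := mx2 1 s 0 1.

Lemma det_unipotent s : \det (unipotent s) = 1.
Proof. by rewrite det_mx2; ring. Qed.

(** Lower triangular matrices are a section of the first column, so that [ell]
    picks a vector on the horocycle of column [(a, y)]. *)
Definition ell a y : T1plane R := dact (mx2 a 0 y a^-1) base.

Lemma det_ell a y : a != 0 -> \det (mx2 a 0 y a^-1) = 1.
Proof. by move=> a0; rewrite det_mx2 mul0r subr0 divff. Qed.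

(** The sign in the choice of a frame is the good one for the base vector. *)
Lemma frame_base : frame base = 1.
Proof.
have i1 : 'i / (0 +i* expR 0) = 1 :> R[i].
  by rewrite expR0 divff// eq_complex /= oner_eq0 andbF.
have vb : val base = (0 +i* expR 0, 0 +i* expR 0) by exact: SubK.
rewrite /frame vb [(_, _).2]/= i1 sqrtc1 mulr1 expR0 /=.
by apply: mx2P; rewrite !mxE.
Qed.

Lemma horocyclic_flowH_base s : horocyclic_flowH s base = dact (unipotent s) base.
Proof.
rewrite /horocyclic_flowH frame_base dact1; apply/val_inj.
have [_ ->] := dact_base_coords (det_unipotent s).
have [-> -> -> ->] := mx2E 1 s 0 1; rewrite SubK !expr0n !expr1n /= !add0r !expr1n !invr1.
by congr (_ +i* _, _ +i* _); ring.
Qed.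

Lemma horocyclic_flowH_dact_base s g : \det g = 1 ->
  horocyclic_flowH s (dact g base) = dact (g * unipotent s) base.
Proof.
move=> dg; rewrite horocyclic_flowH_dact// horocyclic_flowH_base dactM//.
exact: det_unipotent.
Qed.

Lemma geodesic_flowH_base t : geodesic_flowH t base = ell (expR (t / 2)) 0.
Proof.
rewrite /geodesic_flowH frame_base dact1; apply/val_inj; rewrite /ell.
have e0 : expR (t / 2) != 0 by rewrite gt_eqF ?expR_gt0.
have [_ ->] := dact_base_coords (det_ell 0 e0).
have [-> -> -> ->] := mx2E (expR (t / 2)) 0 0 (expR (t / 2))^-1.
rewrite SubK (_ : expR t = expR (t / 2) ^+ 2).
  by congr (_ +i* _, _ +i* _); field.
by rewrite expr2 -expRD -splitr.
Qed.

Lemma ell1 : ell 1 0 = base.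
Proof. by rewrite /ell (_ : mx2 _ _ _ _ = 1) ?dact1//; apply: mx2P; rewrite !mxE /= ?invr1. Qed.

Lemma horo_form_horocyclic a b s u :
  horo_form a b (horocyclic_flowH s u) = horo_form a b u.
Proof.
have [g dg ->] := T1plane_dact u.
rewrite horocyclic_flowH_dact_base// !horo_form_dact//; last first.
  by rewrite det_mulmx dg det_unipotent mulr1.
by rewrite !mulmx2E !mxE /=; ring.
Qed.

Lemma horo_form_dactM a b A u : \det A = 1 ->
  horo_form a b (dact A u) = horo_form (a * A 0 0 + b * A 1 0) (a * A 0 1 + b * A 1 1) u.
Proof.
move=> dA; have [g dg ->] := T1plane_dact u.
rewrite -dactM// !horo_form_dact//; last by rewrite det_mulmx dA dg mulr1.
by rewrite !mulmx2E; ring.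
Qed.

Lemma Re_continuous : continuous (@complex.Re R).
Proof.
move=> z; apply: (@continuous_comp _ _ _ (fun z : R[i] => (Re z, Im z) : R * R) fst).
  exact: initial_continuous.
exact: cvg_fst.
Qed.

Lemma Im_continuous : continuous (@complex.Im R).
Proof.
move=> z; apply: (@continuous_comp _ _ _ (fun z : R[i] => (Re z, Im z) : R * R) snd).
  exact: initial_continuous.
exact: cvg_snd.
Qed.

Lemma initial_cvg (T : Type) (F : set_system T) (S : choiceType)
    (X : topologicalType) (w : S -> X) (f : T -> initial_topology w)
    (l : initial_topology w) :
  Filter F -> (w \o f) x @[x --> F] --> w l -> f @ F --> l.
Proof.
move=> FF cf U [?/= [[W oW <-]]] /= Wl sWU; apply: filterS sWU _; apply: cf.
exact: open_nbhs_nbhs.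
Qed.

Lemma T1plane_cvg (T : Type) (F : set_system T) (f : T -> T1plane R) u :
  Filter F ->
  (Re (val (f x)).1 @[x --> F] --> Re (val u).1) ->
  (Im (val (f x)).1 @[x --> F] --> Im (val u).1) ->
  (Re (val (f x)).2 @[x --> F] --> Re (val u).2) ->
  (Im (val (f x)).2 @[x --> F] --> Im (val u).2) ->
  f @ F --> u.
Proof.
move=> FF c1 c2 c3 c4; apply: initial_cvg.
have h1 : (fun x => (val (f x)).1) @ F --> (val u).1.
  by apply: initial_cvg; exact: (cvg_pair c1 c2).
have h2 : (fun x => (val (f x)).2) @ F --> (val u).2.
  by apply: initial_cvg; exact: (cvg_pair c3 c4).
have h : (fun x => ((val (f x)).1, (val (f x)).2)) @ F --> ((val u).1, (val u).2).
  exact: (cvg_pair h1 h2).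
rewrite -surjective_pairing in h.
rewrite (_ : (fun x => _) = (fun x => val (f x))) in h; first exact: h.
by apply/funext => x; rewrite -surjective_pairing.
Qed.

Section RealLimits.
Variables (T : Type) (F : set_system T) (FF : Filter F).
Implicit Types (f h : T -> R).

Lemma limD f h a b : f @ F --> a -> h @ F --> b -> f x + h x @[x --> F] --> a + b.
Proof. exact: cvgD. Qed.

Lemma limB f h a b : f @ F --> a -> h @ F --> b -> f x - h x @[x --> F] --> a - b.
Proof. exact: cvgB. Qed.

Lemma limM f h a b : f @ F --> a -> h @ F --> b -> f x * h x @[x --> F] --> a * b.
Proof. exact: cvgM. Qed.

Lemma limV f a : a != 0 -> f @ F --> a -> (f x)^-1 @[x --> F] --> a^-1.
Proof. exact: cvgV. Qed.

Lemma limC a : (fun _ : T => a) @ F --> a.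
Proof. exact: cvg_cst. Qed.

End RealLimits.
Arguments limC {T F} FF a.

Lemma val_continuous : continuous (fun u : T1plane R => val u).
Proof. exact: initial_continuous. Qed.

Lemma horo_form_continuous a b : continuous (horo_form a b).
Proof.
move=> u.
have c1 : (val v).1 @[v --> u] --> (val u).1.
  by apply: (continuous_comp (@val_continuous u)); exact: cvg_fst.
have c2 : (val v).2 @[v --> u] --> (val u).2.
  by apply: (continuous_comp (@val_continuous u)); exact: cvg_snd.
have cx : Re (val v).1 @[v --> u] --> Re (val u).1.
  exact: (continuous_cvg _ (@Re_continuous _) c1).
have cy : Im (val v).1 @[v --> u] --> Im (val u).1.
  exact: (continuous_cvg _ (@Im_continuous _) c1).
have cp : Re (val v).2 @[v --> u] --> Re (val u).2.
  exact: (continuous_cvg _ (@Re_continuous _) c2).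
have cq : Im (val v).2 @[v --> u] --> Im (val u).2.
  exact: (continuous_cvg _ (@Im_continuous _) c2).
have y0 : Im (val u).1 != 0.
  by rewrite gt_eqF//; have [] := set_mem (valP u).
have FF := nbhs_filter u.
have cw := limD FF (limM FF (limC FF a) cx) (limC FF b).
have cay := limM FF (limC FF a) cy.
have cw2 := limM FF cw cw.
have cay2 := limM FF cay cay.
exact: (limM FF (limB FF (limM FF (limD FF cw2 cay2) (limV FF y0 cy))
  (limM FF (limB FF (limM FF (limB FF cw2 cay2) cq)
                    (limM FF (limM FF (limM FF (limC FF 2) cw) cay) cp))
     (limV FF (mulf_neq0 y0 y0) (limM FF cy cy)))) (limC FF 2^-1)).
Qed.

Lemma ell_cvg (T : Type) (F : set_system T) (FF : Filter F) (f h : T -> R) a :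
  a != 0 -> f @ F --> a -> h @ F --> 0 ->
  (fun x => ell (f x) (h x)) @ F --> ell a 0.
Proof.
move=> a0 ca cy.
have civ := limV FF a0 ca.
have cn := limD FF (limM FF cy cy) (limM FF civ civ).
have n0 : 0 * 0 + a^-1 * a^-1 != 0 :> R by rewrite mul0r add0r mulf_neq0 ?invr_eq0.
have cnV := limV FF n0 cn.
have cn2V := limV FF (mulf_neq0 n0 n0) (limM FF cn cn).
have E b y : b != 0 -> val (ell b y) =
  (((b * y + 0 * b^-1) / (y * y + b^-1 * b^-1) +i* (y * y + b^-1 * b^-1)^-1),
   (2 * y * b^-1 / ((y * y + b^-1 * b^-1) * (y * y + b^-1 * b^-1)) +i*
    ((b^-1 * b^-1 - y * y) / ((y * y + b^-1 * b^-1) * (y * y + b^-1 * b^-1))))).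
  move=> b0; have [_] := dact_base_coords (det_ell y b0).
  by have [-> -> -> ->] := mx2E b 0 y b^-1; rewrite -!expr2.
have na := cvgr_neq0 _ ca a0.
have eqF (k k' : T -> R) (l : R) : (forall x, f x != 0 -> k x = k' x) ->
    k @ F --> l -> k' @ F --> l.
  move=> kk' ck U lU; have kU : F (k @^-1` U) := ck U lU.
  have na' : F (fun x => f x != 0) := na FF.
  change (F (k' @^-1` U)); apply: filterS2 na' kU => x x0.
  by rewrite /= kk'.
apply: T1plane_cvg; rewrite E//=.
- apply: eqF (limM FF (limD FF (limM FF ca cy) (limM FF (limC FF 0) civ)) cnV).
  by move=> p p0; rewrite E.
- by apply: eqF cnV => p p0; rewrite E.
- apply: eqF (limM FF (limM FF (limM FF (limC FF 2) cy) civ) cn2V) => p p0.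
  by rewrite E.
- apply: eqF (limM FF (limB FF (limM FF civ civ) (limM FF cy cy)) cn2V) => p p0.
  by rewrite E.
Qed.

End Frames.
Arguments ell_cvg {R T F} FF {f h a} _ _ _.

(** * The horocyclic orbit of the base vector *)

Section Orbit.
Variable R : realType.
Implicit Types (A B : 'M[R]_2) (u : T1plane R) (a b s t : R).

Local Notation S := (wmx_surface R).
Local Notation pi u := (\pi_(T1surface S) u).

Definition u0 : T1surface S := pi (base R).

(** The horocycle of the base vector meets, modulo the group, every vector of
    the section whose column is the first column of a group element. *)
Lemma orbit_ell A : wmx_group A -> A 0 0 != 0 ->
  horocyclic_orbit u0 (pi (ell (A 0 0) (A 1 0))).
Proof.
move=> GA a0; have dA := wmx_group_det GA.
exists (- A 0 1 / A 0 0) => //; rewrite horocyclic_flow_pi horocyclic_flowH_base.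
apply/T1surface_eqP; exists A => //; rewrite -dactM ?det_unipotent//.
congr dact; apply: mx2P; rewrite mulmx2E !mxE /=; try by field.
have -> : A 1 1 = (1 + A 0 1 * A 1 0) / A 0 0.
  by apply: (mulIf a0); rewrite mulfVK// -dA det2; ring.
by field.
Qed.

Lemma radius_ge n : n.+1%:R <= radius R n.
Proof.
elim: n => // n IH; rewrite radiusS -[n.+2%:R]/((1 + n.+1)%:R) natrD.
have := shift_ge9 R n; have : 1 <= n.+1%:R :> R by rewrite ler1n.
nra.
Qed.

Lemma radiusV_lt e : 0 < e -> exists n, (radius R n)^-1 < e.
Proof.
move=> e0; exists (Num.truncn e^-1); rewrite invf_plt ?posrE ?radius_gt0//.
by apply: lt_le_trans (radius_ge _); rewrite truncnS_gt.
Qed.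

(** A generator of large index almost multiplies by 3 the vectors that are close
    enough to the horizontal axis; how close depends on its upper right entry,
    so that the generator is chosen first. *)
Lemma wmx_group_approx k e : 0 < e ->
  exists A, [/\ wmx_group A, `|A 0 0 - 3 ^+ k| < e & `|A 1 0| < e].
Proof.
elim: k e => [|k IH] e e0.
  by exists 1; split; [exact: wmx_group1| |]; rewrite !mxE /= ?expr0 ?subrr normr0.
have p3 : 0 < 3 ^+ k :> R by rewrite exprn_gt0.
have [|n rn] := @radiusV_lt (e / (2 * (3 ^+ k + 1))).
  by rewrite divr_gt0// mulr_gt0//; lra.
rewrite ltr_pdivlMr in rn; last by rewrite mulr_gt0//; lra.
have r0 := radius_gt0 R n; have D9 := shift_ge9 R n.
set D := shift R n in D9 *; set r := radius R n in rn r0 *.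
pose K := 3 + (3 * D + 1) * r + D.
have D1 : 0 < (3 * D + 1) * r by rewrite mulr_gt0//; lra.
have K0 : 0 < K by rewrite /K; lra.
have [|A [GA A0 A1]] := IH (Num.min 1 (e / (2 * K))).
  by rewrite lt_min ltr01 divr_gt0// mulr_gt0.
move: A0 A1; rewrite !lt_min => /andP[A01 A0] /andP[_ A1].
rewrite ltr_pdivlMr ?mulr_gt0// in A0; rewrite ltr_pdivlMr ?mulr_gt0// in A1.
exists (gen R (n, true) * A); split.
- by apply: wmx_groupM GA; rewrite -wmx1; exact: wmx_group_word.
- rewrite mulmx2E /gen !mxE /= -/D -/r exprS.
  rewrite (_ : _ - _ = 3 * (A 0 0 - 3 ^+ k) - (3 * D + 1) * r * A 1 0); last by ring.
  apply: le_lt_trans (ler_normB _ _) _; rewrite !normrM (gtr0_norm r0).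
  rewrite (@ger0_norm _ 3)// (@ger0_norm _ (3 * D + 1)); last lra.
  have h1 : 3 * `|A 0 0 - 3 ^+ k| <= K * `|A 0 0 - 3 ^+ k|.
    by rewrite ler_wpM2r// /K; lra.
  have h2 : (3 * D + 1) * r * `|A 1 0| <= K * `|A 1 0|.
    by rewrite ler_wpM2r// /K; lra.
  lra.
- rewrite mulmx2E /gen !mxE /= -/D -/r.
  apply: le_lt_trans (ler_normD _ _) _; rewrite !normrM normrN normfV.
  rewrite (gtr0_norm r0) (@ger0_norm _ D); last lra.
  have h2 : D * `|A 1 0| <= K * `|A 1 0| by rewrite ler_wpM2r// /K; lra.
  have h3 : `|A 0 0| <= 3 ^+ k + 1.
    rewrite -[A 0 0](subrK (3 ^+ k)) addrC; apply: le_trans (ler_normD _ _) _.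
    by rewrite (gtr0_norm p3) lerD2l ltW.
  have h4 : r^-1 * `|A 0 0| <= r^-1 * (3 ^+ k + 1).
    by rewrite ler_wpM2l// invr_ge0 ltW.
  rewrite mulrCA in rn; rewrite mulrCA (mulrC _ K) in A1.
  by move: h2 h4 rn A1; move: (r^-1 * _) (r^-1 * _) (D * _) (K * _) => *; lra.
Qed.

Lemma nbhs_pi u (U : set (T1surface S)) :
  nbhs (pi u) U -> nbhs u [set v | U (pi v)].
Proof. exact: (@pi_continuous _ _ u U). Qed.

Lemma radiusV_cvg c (g : nat -> R) :
  (forall n, `|g n| <= c * (radius R n)^-1) -> g @ \oo --> (0 : R).
Proof.
move=> gn; apply/cvgr0Pnorm_lt => e e0.
have c1 : 0 < `|c| + 1 by rewrite ltr_wpDl.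
have [N rN] := radiusV_lt (divr_gt0 e0 c1).
exists N => // n /= Nn; apply: le_lt_trans (gn n) _.
rewrite ltr_pdivlMr// in rN; apply: le_lt_trans rN.
have rnN : (radius R n)^-1 <= (radius R N)^-1.
  by rewrite lef_pV2 ?posrE ?radius_gt0// radius_le.
have r0 : 0 < (radius R n)^-1 by rewrite invr_gt0 radius_gt0.
have := ler_norm c; nra.
Qed.

Lemma closure_u0 k : closure (horocyclic_orbit u0) (pi (ell (3 ^+ k) 0)).
Proof.
have p3 : 3 ^+ k != 0 :> R by rewrite expf_neq0.
have ex n : exists A : 'M[R]_2, [/\ wmx_group A,
    `|A 0 0 - 3 ^+ k| < (radius R n)^-1 & `|A 1 0| < (radius R n)^-1].
  by apply: wmx_group_approx; rewrite invr_gt0 radius_gt0.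
have [f fP] := choice ex.
have f1 : (f n 0 0) @[n --> \oo] --> (3 ^+ k : R).
  apply/subr_cvg0; apply: (@radiusV_cvg 1) => n.
  by rewrite mul1r ltW//; have [] := fP n.
have f2 : (f n 1 0) @[n --> \oo] --> (0 : R).
  by apply: (@radiusV_cvg 1) => n; rewrite mul1r ltW//; have [] := fP n.
have fc := ell_cvg eventually_filter p3 f1 f2.
move=> U Uk.
have : \forall n \near \oo, U (pi (ell (f n 0 0) (f n 1 0))).
  exact: (fc _ (nbhs_pi Uk)).
move=> [N _ /(_ N (leqnn N)) UN].
exists (pi (ell (f N 0 0) (f N 1 0))); split=> //.
have [GN _ _] := fP N; apply: orbit_ell => //.
by rewrite -normr_gt0; apply: lt_le_trans (wmx_group_fst GN).
Qed.

(** There is a vector [ell a x] whose column is mapped by [gen (n, true)] to a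
    column [(a, y)] with the same first coordinate. Both [x] and [y] tend to 0
    with [n], while the upper right entry of [gen (n, true)] forces a long way
    along the horocycle before the image reaches [ell a y]. *)
Lemma nonwandering_ell a : 0 < a -> nonwandering (pi (ell a 0)).
Proof.
move=> a0 U Ua t; have an0 := lt0r_neq0 a0.
pose b n := (3 * shift R n + 1) * radius R n.
have b0 n : 0 < b n.
  by rewrite mulr_gt0 ?radius_gt0//; have := shift_ge9 R n; lra.
pose x n := 2 * a / b n.
pose y n := (radius R n)^-1 * a - shift R n * x n.
have rn0 n : radius R n != 0 by rewrite gt_eqF ?radius_gt0.
have Dn0 n : 3 * shift R n + 1 != 0 by rewrite gt_eqF//; have := shift_ge9 R n; lra.
have xE n : x n = (2 * a / (3 * shift R n + 1)) * (radius R n)^-1.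
  by rewrite /x /b; field; rewrite Dn0 rn0.
have yE n : y n = a * (1 - 2 * shift R n / (3 * shift R n + 1)) * (radius R n)^-1.
  by rewrite /y xE; field; rewrite Dn0 rn0.
have rV n : 0 <= (radius R n)^-1 by rewrite invr_ge0 ltW// radius_gt0.
have cx : x @ \oo --> (0 : R).
  apply: (@radiusV_cvg (2 * a)) => n; have D9 := shift_ge9 R n.
  rewrite xE normrM (ger0_norm (rV n)) ler_wpM2r//.
  rewrite ger0_norm; last by rewrite divr_ge0// ?mulr_ge0 ?ltW//; lra.
  by rewrite ler_pdivrMr ?ler_peMr ?mulr_ge0 ?ltW//; lra.
have cy : y @ \oo --> (0 : R).
  apply: (@radiusV_cvg a) => n; have D9 := shift_ge9 R n.
  rewrite yE normrM (ger0_norm (rV n)) ler_wpM2r//.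
  rewrite normrM (gtr0_norm a0) -[leRHS]mulr1 ler_wpM2l ?(ltW a0)//.
  have h : 0 <= 2 * shift R n / (3 * shift R n + 1) <= 1.
    apply/andP; split; first by rewrite divr_ge0//; lra.
    by rewrite ler_pdivrMr; lra.
  by move: h; move: (_ / _) => q /andP[q0 q1]; rewrite ger0_norm; lra.
have ca : (fun _ : nat => a) @ \oo --> (a : R) by exact: cvg_cst.
have [N1 _ UN1] := ell_cvg eventually_filter an0 ca cx _ (nbhs_pi Ua).
have [N2 _ UN2] := ell_cvg eventually_filter an0 ca cy _ (nbhs_pi Ua).
pose N3 := Num.truncn (`|t| * a ^+ 2).
pose n := maxn N1 (maxn N2 N3).
exists (b n / a ^+ 2).
  rewrite ltr_pdivlMr ?exprn_gt0//.
  have : t * a ^+ 2 <= `|t| * a ^+ 2 by rewrite ler_wpM2r ?sqr_ge0// ler_norm.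
  move/le_lt_trans; apply.
  apply: lt_le_trans (truncnS_gt _) _; rewrite -/N3.
  have : N3.+1%:R <= n.+1%:R :> R by rewrite ler_nat ltnS /n !leq_max leqnn !orbT.
  move/le_trans; apply; apply: le_trans (radius_ge n) _.
  by rewrite ler_peMl ?(ltW (radius_gt0 _ _))//; have := shift_ge9 R n; lra.
exists (pi (ell a (y n))); split; last by apply: UN2; rewrite /n /= !leq_max leqnn orbT.
exists (pi (ell a (x n))); first by apply: UN1; rewrite /n /= !leq_max leqnn.
rewrite horocyclic_flow_pi horocyclic_flowH_dact_base ?det_ell//.
apply/T1surface_eqP; exists (gen R (n, true)).
  by rewrite -[S _]/(wmx_group _) -wmx1; exact: wmx_group_word.
rewrite -dactM ?det_gen//; last by rewrite det_mulmx det_ell// det_unipotent mulr1.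
have bn0 : b n != 0 by rewrite gt_eqF.
congr dact; apply: mx2P; rewrite !mulmx2E !mxE /= -/(b n).
- by rewrite /x; field; rewrite ?bn0 ?an0.
- by rewrite /x; field; rewrite ?bn0 ?an0.
- by rewrite /y; ring.
- rewrite xE /b; field.
  by rewrite an0 rn0 Dn0.
Qed.

(** The vectors all of whose lifts have a column with first coordinate of square
    at least [m]. *)
Definition horo_ge m : set (T1surface S) :=
  [set v | forall A, S A -> m <= horo_form (A 0 0) (A 0 1) (repr v)].

Lemma horo_ge_pi m u :
  horo_ge m (pi u) <-> forall A, wmx_group A -> m <= horo_form (A 0 0) (A 0 1) u.
Proof.
have := (T1surface_eqP S _ u).1 (reprK (pi u)).
rewrite /horo_ge /=; move: (repr _) => v [B SB <-].
have GB : wmx_group B := SB.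
have dB := wmx_group_det GB.
have uB : B \is a GRing.unit by rewrite unitmxE dB unitr1.
split=> h A GA.
  rewrite horo_form_dactM// -!mulmx2E.
  by apply: h; exact: (wmx_groupM GA GB).
have := h _ (wmx_groupM GA (wmx_groupV GB)).
by rewrite horo_form_dactM// -!mulmx2E -mulrA mulVr// mulr1.
Qed.

Lemma horo_ge_closed m : closed (horo_ge m).
Proof.
rewrite -[horo_ge m]setCK; apply: open_closedC.
have : open [set u : T1plane R | ~ horo_ge m (pi u)].
  rewrite (_ : [set u | _] = ~` \bigcap_(A in @wmx_group R)
      [set u | m <= horo_form (A 0 0) (A 0 1) u]).
    apply: closed_openC; apply: closed_bigI => A _.
    have := @closed_comp _ _ (horo_form (A 0 0) (A 0 1)) [set x | m <= x].
    by apply=> [x _|]; [exact: horo_form_continuous|exact: closed_ge].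
  apply/seteqP; split=> u /= h h'; apply: h.
    by apply/horo_ge_pi => A GA; exact: h'.
  by move=> A GA; exact: (horo_ge_pi m u).1 h' A GA.
by [].
Qed.

Lemma horo_ge_invariant m : horocyclic_invariant (horo_ge m).
Proof.
move=> s v; rewrite -[v]reprK horocyclic_flow_pi => /horo_ge_pi h.
by apply/horo_ge_pi => A GA; rewrite horo_form_horocyclic; exact: h.
Qed.

Lemma horo_ge_ell a : a != 0 -> horo_ge (a ^+ 2) (pi (ell a 0)).
Proof.
move=> a0; apply/horo_ge_pi => A GA; rewrite horo_form_dact ?det_ell// !mxE /=.
rewrite mulr0 addr0 exprMn ler_peMl ?sqr_ge0// -[1](expr1n _ 2).
by rewrite -[leRHS]real_normK ?num_real// ler_pXn2r ?nnegrE// wmx_group_fst.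
Qed.

Lemma horo_ge_ellN a m : a ^+ 2 < m -> a != 0 -> ~ horo_ge m (pi (ell a 0)).
Proof.
move=> am a0 /horo_ge_pi /(_ _ (wmx_group1 R)).
rewrite horo_form_dact ?det_ell// !mxE /= mul1r mul0r addr0.
by rewrite leNgt am.
Qed.

Lemma u0E : u0 = pi (ell 1 0). Proof. by rewrite ell1. Qed.

Lemma closure_u0_sub : closure (horocyclic_orbit u0) `<=` horo_ge 1.
Proof.
move=> x xc; apply: horo_ge_closed; apply: closureS xc => {x}.
move=> _ [s _ <-]; apply: horo_ge_invariant; rewrite u0E.
by have := horo_ge_ell (oner_neq0 R); rewrite expr1n.
Qed.

Lemma geodesic_u0 k :
  geodesic_flow (k%:R * (2 * ln 3)) u0 = pi (ell (3 ^+ k) 0).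
Proof.
rewrite geodesic_flow_pi geodesic_flowH_base.
rewrite (_ : _ / 2 = k%:R * ln 3); last by field.
by rewrite expRM_natl lnK// posrE.
Qed.

(** If the orbit were closed it would contain the vector of column [3 e1], but an
    element of the group that fixes the direction of [e1] is trivial. It is not
    dense in the nonwandering set, which contains the vector of column
    [e1 / 3]. *)
Lemma irregular_u0 : irregular_orbit u0.
Proof.
split; first by rewrite u0E; exact: nonwandering_ell.
- move=> cl; have := @closure_u0 1; rewrite -(closure_id _).1// => -[s _].
  rewrite horocyclic_flow_pi horocyclic_flowH_base => /T1surface_eqP[A GA].
  have dA := wmx_group_det GA.
  rewrite -dactM ?det_unipotent// => E.
  have n30 : 3 ^+ 1 != 0 :> R by rewrite expf_neq0.
  have := congr1 (horo_form 0 1) E; have := congr1 (horo_form 1 0) E.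
  rewrite !horo_form_dact ?det_ell ?det_mulmx ?dA ?det_unipotent ?mulr1//.
  rewrite !mulmx2E !mxE /= !mul1r !mul0r !mulr1 !mulr0 !addr0 !add0r expr1.
  move=> A00 /eqP; rewrite expr0n /= expf_eq0 /= => A10.
  have [] := pselect (nontrivial A) => [nA|].
    have [n [+ _]] := wmx_group_entries GA nA.
    by rewrite (eqP A10) normr0 leNgt invr_gt0 radius_gt0.
  move=> /not_andP[] /negP/negPn/eqP AE; move: A00; rewrite AE !mxE /=; lra.
- move=> sub; have p3 : 0 < 3^-1 :> R by rewrite invr_gt0.
  have := closure_u0_sub (sub _ (nonwandering_ell p3)).
  by apply: horo_ge_ellN; [lra|exact: lt0r_neq0].
Qed.

(** The closure contains the vector of column [3 e1], hence it meets [horo_ge 9],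
    to which [u0] does not belong. *)
Lemma not_minimal_u0 : ~ horocyclic_minimal (closure (horocyclic_orbit u0)).
Proof.
move=> [_ clM invM minM].
have M0 : closure (horocyclic_orbit u0) u0.
  by have := @closure_u0 0; rewrite expr0 -u0E.
have E : closure (horocyclic_orbit u0) `&` horo_ge 9 = closure (horocyclic_orbit u0).
  apply: minM; last exact: subIsetl.
  - exists (pi (ell (3 ^+ 1) 0)); split; first exact: closure_u0.
    have n30 : 3 ^+ 1 != 0 :> R by rewrite expf_neq0.
    by have := horo_ge_ell n30; rewrite (_ : (3 ^+ 1) ^+ 2 = 9)//; ring.
  - by apply: closedI => //; exact: horo_ge_closed.
  - by move=> s v [Mv hv]; split; [exact: invM|exact: horo_ge_invariant].
have : horo_ge 9 u0 by move: M0; rewrite -E => -[].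
by rewrite u0E; apply: horo_ge_ellN; [rewrite expr1n; lra|exact: oner_neq0].
Qed.

Lemma return_times_u0 n : (1 <= n)%N -> return_times u0 (n%:R * (2 * ln 3)).
Proof.
move=> n1; split; last by rewrite geodesic_u0; exact: closure_u0.
by rewrite mulf_neq0// ?pnatr_eq0 -?lt0n// mulf_neq0// gt_eqF// ln_gt0//; lra.
Qed.

Lemma return_times_cvg : (n%:R * (2 * ln 3) : R) @[n --> \oo] --> +oo.
Proof.
have l0 : 0 < 2 * ln 3 :> R by rewrite mulr_gt0// ln_gt0//; lra.
apply/cvgryPge => M; apply: filterS (nbhs_infty_ger (M / (2 * ln 3))) => n.
by rewrite ler_pdivrMr.
Qed.

End Orbit.

(** * Injectivity radius along the ray *)

Section Fineness.
Variable R : realType.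
Implicit Types (A B : 'M[R]_2) (z : plane R) (y : R).

Local Notation S := (wmx_surface R).

Lemma hdist_act_vertical A z y : \det A = 1 -> val z = 0 +i* y ->
  hdist z (act A z) =
  acosh ((A 0 0 ^+ 2 + A 0 1 ^+ 2 / y ^+ 2 + A 1 0 ^+ 2 * y ^+ 2 + A 1 1 ^+ 2) / 2).
Proof.
move=> dA zE; have := plane_gt0 z; rewrite /hdist val_act// zE [X in 0 < X]/= => y0.
have y1 := lt0r_neq0 y0.
have d0 : mobius_den A (0 +i* y) != 0 by rewrite mobius_den_neq0.
pose n := (A 1 0 * y) ^+ 2 + A 1 1 ^+ 2.
have nE : n = sqnorm (mobius_den A (0 +i* y)).
  by rewrite /n /sqnorm /mobius_den /=; ring.
have n0 : n != 0 by rewrite nE gt_eqF// sqnorm_gt0.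
have -> : mobius A (0 +i* y) =
    ((A 0 1 * A 1 1 + A 0 0 * A 1 0 * y ^+ 2) / n) +i* (y / n).
  rewrite /mobius -[RHS](mulfK d0); congr (_ / _).
  have -> : y / n = (A 0 0 * A 1 1 - A 0 1 * A 1 0) * y / n by rewrite -det2 dA mul1r.
  rewrite /mobius_num /mobius_den.
  by apply/eqP; rewrite eq_complex /=; apply/andP; split; apply/eqP; rewrite /n; field.
congr acosh; rewrite /sqnorm /=.
apply/eqP; rewrite -subr_eq0; apply/eqP.
have E : (A 0 1 * A 1 1 + A 0 0 * A 1 0 * y ^+ 2) ^+ 2 + y ^+ 2
    = (A 0 0 ^+ 2 * y ^+ 2 + A 0 1 ^+ 2) * n.
  have -> : (A 0 1 * A 1 1 + A 0 0 * A 1 0 * y ^+ 2) ^+ 2 + y ^+ 2 =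
      (A 0 1 * A 1 1 + A 0 0 * A 1 0 * y ^+ 2) ^+ 2
      + (A 0 0 * A 1 1 - A 0 1 * A 1 0) ^+ 2 * y ^+ 2.
    by rewrite -det2 dA expr1n mul1r.
  by rewrite /n; ring.
pose w := A 0 1 * A 1 1 + A 0 0 * A 1 0 * y ^+ 2.
transitivity ((w ^+ 2 + y ^+ 2 - (A 0 0 ^+ 2 * y ^+ 2 + A 0 1 ^+ 2) * n)
              / (2 * y ^+ 2 * n)); last by rewrite E subrr mul0r.
have -> : A 1 1 ^+ 2 = n - A 1 0 ^+ 2 * y ^+ 2 by rewrite /n; ring.
by rewrite -/w; field; rewrite n0 y1.
Qed.

Lemma acosh_ge (x K : R) : expR K <= x -> K <= acosh x.
Proof.
move=> Kx; have x0 : 0 < x by apply: lt_le_trans Kx; exact: expR_gt0.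
apply: le_trans (_ : ln x <= _).
  by rewrite -[leLHS](expRK K) ler_ln ?posrE ?expR_gt0.
by rewrite /acosh ler_ln ?posrE// ?ltr_wpDr ?lerDl ?sqrtr_ge0.
Qed.

(** At height [expR t] the letters of index at least [N] displace the point by
    their diagonal entries, and the finitely many others by [c * expR t]. *)
Lemma asymptotic_fineness_u0 : asymptotic_fineness (u0 R) = +oo%E.
Proof.
apply/eq_infty => K; rewrite /asymptotic_fineness limf_einfE.
pose M := 2 * expR K + 1; have eK := expR_gt0 K.
pose N := Num.truncn M.
have MN : M < shift R N.
  by apply: lt_le_trans (truncnS_gt M) _; rewrite /shift -natr1 lerD2l; lra.
have M1 : 1 <= M by rewrite /M; lra.
have rN := radius_gt0 R N.
apply: (@le_trans _ _ (ereal_inf ((fun t => Defs.Inj (geodesic_ray (u0 R) t)) @`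
    [set t | ln (radius R N * M) < t]))); last first.
  apply: ereal_sup_ubound; exists [set t | ln (radius R N * M) < t] => //.
  by exists (ln (radius R N * M)); split; [exact: num_real|].
apply: le_ereal_inf_tmp => _ [t /= ht <-].
rewrite /geodesic_ray /u0 geodesic_flow_pi foot_pi Inj_pi.
apply: le_ereal_inf_tmp => _ [A [GA nA] <-]; rewrite lee_fin.
have dA := wmx_group_det GA.
have zE : val (base_point (geodesic_flowH t (base R))) = 0 +i* expR t.
  rewrite val_base_point /geodesic_flowH frame_base dact1.
  by rewrite SubK.
rewrite (hdist_act_vertical dA zE); apply: acosh_ge.
have ty : radius R N * M < expR t.
  by rewrite -[ltLHS]lnK ?ltr_expR// posrE mulr_gt0//; lra.
have y0 := expR_gt0 t; have y2 : 0 <= A 0 1 ^+ 2 / expR t ^+ 2.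
  by rewrite mulr_ge0 ?invr_ge0 ?sqr_ge0.
have a2 := sqr_ge0 (A 0 0); have d2 := sqr_ge0 (A 1 1).
have c2 : 0 <= A 1 0 ^+ 2 * expR t ^+ 2 by rewrite mulr_ge0 ?sqr_ge0.
rewrite ler_pdivlMr//.
suff [h|[h|h]] : M <= A 0 0 ^+ 2 \/ M <= A 1 1 ^+ 2 \/ M <= A 1 0 ^+ 2 * expR t ^+ 2.
  by rewrite /M in h; lra.
  by rewrite /M in h; lra.
  by rewrite /M in h; lra.
have sqM (x : R) : M <= `|x| -> M <= x ^+ 2.
  by move=> Mx; rewrite -(@real_normK _ x) ?num_real//; nra.
have [n [cn mn]] := wmx_group_entries GA nA.
have [nN|Nn] := ltnP n N; last first.
  have : M <= shift R n by apply: le_trans (ltW MN) _; rewrite /shift lerD2r ler_nat.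
  by case: mn => h1 h2; [left|right; left]; apply: sqM; exact: le_trans h2 h1.
right; right; rewrite -exprMn; apply: sqM.
rewrite normrM (gtr0_norm y0); have rn := radius_gt0 R n.
apply: le_trans (_ : (radius R n)^-1 * expR t <= _); last by rewrite ler_wpM2r// ltW.
rewrite ler_pdivlMl//; apply: le_trans (ltW ty).
by rewrite ler_wpM2r ?radius_le ?(ltnW nN)//; lra.
Qed.

End Fineness.

(** * Half-planes and their points at infinity *)

Section HalfPlanes.
Variable R : realType.
Implicit Types (A B : 'M[R]_2) (z p q : plane R) (t X Y : R).

Local Notation S := (wmx_surface R).

Lemma acosh_le (x y : R) : 1 <= x -> 1 <= y -> (acosh x <= acosh y) = (x <= y).
Proof.
have arg_gt0 (a : R) : 1 <= a -> 0 < a + Num.sqrt (a ^+ 2 - 1).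
  by move=> a1; rewrite ltr_wpDr ?sqrtr_ge0//; lra.
have mono (a b : R) : 1 <= a -> a <= b ->
    Num.sqrt (a ^+ 2 - 1) <= Num.sqrt (b ^+ 2 - 1).
  by move=> a1 ab; rewrite ler_wsqrtr// lerD2r ler_pXn2r// nnegrE; lra.
move=> x1 y1; rewrite /acosh ler_ln ?posrE ?arg_gt0//.
have [xy|yx] := leP x y; first by rewrite lerD// mono.
by apply/negbTE; rewrite -ltNge ltr_leD// mono// ltW.
Qed.

(** The defining function of a half-plane: after division by the imaginary
    parts, the terms that involve the imaginary part of the variable cancel,
    and what is left is affine in [X = |z|^2] and [Y = Re z]. *)
Definition side p q X Y : R :=
  (X - 2 * Re (val q) * Y + sqnorm (val q)) / Im (val q)
  - (X - 2 * Re (val p) * Y + sqnorm (val p)) / Im (val p).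

Lemma half_planeE p q z :
  half_plane (p, q) z <-> 0 <= side p q (sqnorm (val z)) (Re (val z)).
Proof.
have z0 := plane_gt0 z; have p0 := plane_gt0 p; have q0 := plane_gt0 q.
rewrite -[half_plane (p, q) z]/(is_true (hdist z p <= hdist z q)) /hdist acosh_le; last first.
- by rewrite lerDl divr_ge0 ?addr_ge0 ?sqr_ge0// !mulr_ge0// ltW.
- by rewrite lerDl divr_ge0 ?addr_ge0 ?sqr_ge0// !mulr_ge0// ltW.
rewrite lerD2l /side -subr_ge0.
move: (val z) (val p) (val q) z0 p0 q0 => [x y] [a b] [c d] /= y0 b0 d0.
set L := (X in 0 <= X <-> _); set L' := (X in _ <-> 0 <= X).
have -> : L = L' / (2 * y).
  rewrite /L /L' /sqnorm /=. by field; rewrite !gt_eqF.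
by rewrite pmulr_lge0// invr_gt0 mulr_gt0.
Qed.

Lemma sideD p q X Y X' Y' t :
  side p q ((1 - t) * X + t * X') ((1 - t) * Y + t * Y') =
  (1 - t) * side p q X Y + t * side p q X' Y'.
Proof. by rewrite /side; ring. Qed.

Definition region (P : set (plane R * plane R)) : set (plane R) :=
  [set z | forall pq, P pq -> half_plane pq z].
(** The real boundary points of [region P]; the coordinates of a real [t] are
    [(t ^ 2, t)]. *)
Definition ideal (P : set (plane R * plane R)) : set R :=
  [set t | forall pq, P pq -> 0 <= side pq.1 pq.2 (t ^+ 2) t].

(** The segment from the boundary point [t] to an interior point, in the
    coordinates [(|z|^2, Re z)] in which half-planes are affine. *)
Lemma chord_point z0 t s : 0 < s <= 1 -> exists z : plane R,
  sqnorm (val z) = (1 - s) * t ^+ 2 + s * sqnorm (val z0) /\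
  Re (val z) = (1 - s) * t + s * Re (val z0).
Proof.
move=> /andP[s0 s1]; have := plane_gt0 z0; case: (val z0) => a b /= b0.
pose X := (1 - s) * t ^+ 2 + s * (a ^+ 2 + b ^+ 2).
pose Y := (1 - s) * t + s * a.
have XY : 0 < X - Y ^+ 2.
  rewrite (_ : _ - _ = s * (1 - s) * (t - a) ^+ 2 + s * b ^+ 2); last by rewrite /X /Y; ring.
  have s1' : 0 <= 1 - s by lra.
  have h1 : 0 <= s * (1 - s) * (t - a) ^+ 2 by apply: mulr_ge0; [apply: mulr_ge0 => //; exact: ltW|exact: sqr_ge0].
  have h2 : 0 < s * b ^+ 2 by rewrite mulr_gt0 ?exprn_gt0.
  lra.
have Z0 : 0 < Im (Y +i* Num.sqrt (X - Y ^+ 2)) by rewrite /= sqrtr_gt0.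
exists (Sub (Y +i* Num.sqrt (X - Y ^+ 2)) (mem_set Z0 : _ \in @upper_half_plane R)).
rewrite SubK /sqnorm /= sqr_sqrtr ?(ltW XY)//; split=> //.
by rewrite addrC subrK.
Qed.

(** The ideal boundary points of a region containing [z0] depend on the region
    only, and not on the half-planes that cut it out. *)
Lemma ideal_eq (P P' : set (plane R * plane R)) z0 :
  region P z0 -> region P = region P' -> ideal P = ideal P'.
Proof.
suff H Q Q' : region Q z0 -> region Q = region Q' -> ideal Q `<=` ideal Q'.
  by move=> Pz PP'; apply/seteqP; split; apply: H => //; rewrite -PP'.
move=> Qz QQ' t Qt [p q] /= Q'pq; rewrite leNgt; apply/negP => neg.
have z0pq : 0 <= side p q (sqnorm (val z0)) (Re (val z0)).
  by apply/half_planeE; move: Qz; rewrite QQ'; apply.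
set a := side p q (t ^+ 2) t in neg; set b := side p q _ _ in z0pq.
(* Halfway to the zero of the affine function on the segment. *)
pose s := - a / (2 * (b - a)).
have ba : 0 < b - a by lra.
have s01 : 0 < s <= 1.
  by rewrite /s; apply/andP; split; [rewrite divr_gt0//|rewrite ler_pdivrMr]; lra.
have [z [zX zY]] := chord_point z0 t s01.
have : region Q' z.
  rewrite -QQ' => -[p' q'] Qpq; apply/half_planeE; rewrite zX zY sideD.
  have h1 : 0 <= side p' q' (t ^+ 2) t by exact: (Qt (p', q')).
  have h2 : 0 <= side p' q' (sqnorm (val z0)) (Re (val z0)).
    by apply/half_planeE; exact: Qz.
  by move: s01 => /andP[s0 s1]; rewrite addr_ge0// mulr_ge0// ?(ltW s0)//; lra.
move=> /(_ _ Q'pq) /half_planeE; rewrite zX zY sideD -/a -/b.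
rewrite (_ : _ + _ = a / 2); first lra.
by rewrite /s; field; rewrite gt_eqF//; lra.
Qed.

Definition side_poly p q : {poly R} :=
  ((Im (val q))^-1 - (Im (val p))^-1) *: 'X^2
  + (2 * (Re (val p) / Im (val p) - Re (val q) / Im (val q))) *: 'X
  + (sqnorm (val q) / Im (val q) - sqnorm (val p) / Im (val p))%:P.

Lemma side_polyE p q t : (side_poly p q).[t] = side p q (t ^+ 2) t.
Proof.
by rewrite /side_poly /side !hornerD !hornerZ hornerXn hornerX hornerC; ring.
Qed.

Lemma side_poly_neq0 p q : p != q -> side_poly p q != 0.
Proof.
apply: contraNneq => E; have p0 := plane_gt0 p; have q0 := plane_gt0 q.
have e0 := side_polyE p q 0; have e1 := side_polyE p q 1.
have e2 := side_polyE p q (-1); rewrite !E !horner0 /side /sqnorm in e0 e1 e2.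
apply/eqP/val_inj; move: (val p) (val q) p0 q0 e0 e1 e2 {E}.
move=> [a b] [c d] /= b0 d0 e0 e1 e2.
have bn := lt0r_neq0 b0; have dn := lt0r_neq0 d0.
have Vdb : d^-1 = b^-1 by lra.
have {}Vdb : d = b by rewrite -[d]invrK Vdb invrK.
rewrite {}Vdb in e0 e1 e2 *; congr (_ +i* _).
have : c / b = a / b by lra.
by move/(mulIf (_ : b^-1 != 0)) => -> //; rewrite invr_eq0.
Qed.

End HalfPlanes.

(** * Points at infinity of the Dirichlet domains *)

Section Minimizers.
Variable R : realType.
Implicit Types (A B : 'M[R]_2) (z : plane R) (v : R * R) (w : seq letter) (t : R).

Lemma seq_argmin (T : eqType) (f : T -> R) x0 (s : seq T) : x0 \in s ->
  exists2 x, x \in s & forall y, y \in s -> f x <= f y.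
Proof.
elim: s x0 => // a s IH x0 _; case: s IH => [_|b s IH].
  by exists a; rewrite ?inE// => y; rewrite inE => /eqP->.
have [x xs xmin] := IH b (mem_head _ _).
have [fax|fxa] := leP (f a) (f x); [exists a|exists x].
- exact: mem_head.
- move=> y; rewrite inE => /predU1P[->//|/xmin]; exact: le_trans.
- by rewrite inE xs orbT.
- by move=> y; rewrite inE => /predU1P[->|/xmin//]; exact: ltW.
Qed.

Fixpoint words (al : seq letter) n : seq (seq letter) :=
  if n is m.+1 then [::] :: [seq a :: w | a <- al, w <- words al m] else [:: [::]].

Lemma wordsP al n w : (size w <= n)%N -> {subset w <= al} -> w \in words al n.
Proof.
elim: n w => [|n IH] [|a w] //= wn wal; rewrite inE /=.
apply/allpairsP; exists (a, w); split => //=; first by apply: wal; exact: mem_head.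
by apply: IH => // b bw; apply: wal; rewrite inE bw orbT.
Qed.

(** The squared modulus of [x - z * y] for a vector [(x, y)]; for a column of a
    matrix this measures the horocycle seen from the point [z]. *)
Definition size_at z v : R :=
  (v.1 - Re (val z) * v.2) ^+ 2 + (Im (val z) * v.2) ^+ 2.

Lemma size_at_scale z c v : size_at z (c * v.1, c * v.2) = c ^+ 2 * size_at z v.
Proof. by rewrite /size_at /=; ring. Qed.

Lemma size_at_bound z M : exists C, forall v, size_at z v <= M ->
  `|v.1| <= C /\ `|v.2| <= C.
Proof.
have z0 := plane_gt0 z; rewrite /size_at; move: (val z) z0 => [a b] /= b0.
have sq (x : R) : x ^+ 2 <= M -> `|x| <= M + 1.
  move=> xM; have [h|h] := leP `|x| 1; first by have := sqr_ge0 x; lra.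
  by rewrite -(@real_normK _ x) ?num_real// in xM; nra.
exists ((M + 1) * (1 + b^-1 + `|a| / b)) => -[x y] /= h.
have /sq h1 : (x - a * y) ^+ 2 <= M by have := sqr_ge0 (b * y); lra.
have /sq h2 : (b * y) ^+ 2 <= M by have := sqr_ge0 (x - a * y); lra.
rewrite normrM (gtr0_norm b0) -ler_pdivlMl// in h2.
have bV : 0 < b^-1 by rewrite invr_gt0.
have M0 : 0 <= M + 1 by apply: le_trans h1; exact: normr_ge0.
have ab : 0 <= `|a| / b by rewrite mulr_ge0// ltW.
have Mab : 0 <= (M + 1) * (`|a| / b) by exact: mulr_ge0.
have MbV : 0 <= (M + 1) * b^-1 by rewrite mulr_ge0// ltW.
rewrite !mulrDr mulr1; split; last by rewrite [b^-1 * _]mulrC in h2; lra.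
have h3 : `|a * y| <= (M + 1) * (`|a| / b).
  rewrite normrM (_ : (M + 1) * _ = `|a| * (b^-1 * (M + 1))); last by ring.
  by rewrite ler_wpM2l.
rewrite -[x](subrK (a * y)); apply: le_trans (ler_normD _ _) _; lra.
Qed.

(** Below a given size there are finitely many words: their length is bounded
    by the growth of the second coordinate, and their letters by the growth of
    the first one. *)
Lemma orbit_min z v : (forall s, outside s v) -> v.2 = 1 ->
  exists2 A, wmx_group A &
    forall B, wmx_group B -> size_at z (app A v) <= size_at z (app B v).
Proof.
move=> ov v2; have [C HC] := size_at_bound z (size_at z v).
pose N := (Num.truncn C).+1.
have CN : C < N%:R by exact: truncnS_gt.
have small w : reduced w -> size_at z (app (wmx R w) v) <= size_at z v ->
    w \in words (allpairs pair (iota 0 N) [:: true; false]) N.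
  move=> rw /HC[h1 h2]; apply: wordsP => [|s sw].
    have [_ + _] := word_expand rw (fun s _ _ => ov (linv s)).
    rewrite v2 normr1 mulr1 => h; rewrite -(ler_nat R); apply/ltW.
    apply: le_lt_trans CN; apply: le_trans h2; apply: le_trans h.
    by rewrite -natrX ler_nat ltnW// ltn_expl.
  have := word_letter_le rw ov sw; rewrite v2 normr1 mulr1 => h.
  apply/allpairsP; exists s; split; last by case: (s).
    rewrite mem_iota add0n /= -(ltr_nat R); apply: lt_trans CN.
    apply: lt_le_trans (le_trans h h1); apply: lt_le_trans (radius_ge _ _).
    by rewrite ltr_nat.
  by case: (s) => ? [].
have w0 : [::] \in words (allpairs pair (iota 0 N) [:: true; false]) N by [].
have [w _ wmin] := seq_argmin (fun w => size_at z (app (wmx R w) v)) w0.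
have nil0 : app (wmx R [::]) v = v by rewrite /wmx big_nil app1.
exists (wmx R w); first exact: wmx_group_word.
move=> B [w' rw' BE].
have -> : size_at z (app B v) = size_at z (app (wmx R w') v).
  by case: BE => -> //; rewrite appN /size_at /=; ring.
have [/(small _ rw')/wmin//|/ltW] := leP (size_at z (app (wmx R w') v)) (size_at z v).
by apply: le_trans; rewrite -{2}nil0; exact: wmin.
Qed.

Definition group_sides z : set (plane R * plane R) :=
  [set pq | exists2 A, wmx_group A & pq = (z, act A z)].

Lemma mx2_inv A : \det A = 1 ->
  [/\ A^-1 0 0 = A 1 1, A^-1 0 1 = - A 0 1, A^-1 1 0 = - A 1 0 & A^-1 1 1 = A 0 0].
Proof.
move=> dA; have uA : A \is a GRing.unit by rewrite unitmxE dA unitr1.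
have -> : A^-1 = mx2 (A 1 1) (- A 0 1) (- A 1 0) (A 0 0); last exact: mx2E.
rewrite -[LHS]mul1r; apply: (mulIr uA); rewrite mulrVK//.
move: dA; rewrite det2 => dA; apply: mx2P; rewrite mulmx2E !mxE /= ?mulNr; lra.
Qed.

(** The bisector of a center and its translate, at a real point, compares the
    sizes of two vectors of the same orbit. *)
Lemma side_group A z t : \det A = 1 ->
  side z (act A z) (t ^+ 2) t =
  (size_at z (app A^-1 (t, 1)) - size_at z (t, 1)) / Im (val z).
Proof.
move=> dA; have z0 := plane_gt0 z; rewrite /side val_act// Im_mobius//.
have d0 := mobius_den_neq0 dA z0.
have sd0 : sqnorm (mobius_den A (val z)) != 0 by rewrite gt_eqF// sqnorm_gt0.
have [i00 i01 i10 i11] := mx2_inv dA.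
rewrite /size_at /app i00 i01 i10 i11.
have -> : t ^+ 2 - 2 * Re (mobius A (val z)) * t + sqnorm (mobius A (val z)) =
    sqnorm (t%:C * mobius_den A (val z) - mobius_num A (val z))
      / sqnorm (mobius_den A (val z)).
  rewrite -sqnormV -sqnormM mulrBl mulfK// -/(mobius A (val z)).
  by case: (mobius A (val z)) => x y; rewrite /sqnorm /=; ring.
have cancel (a : R) : a / sqnorm (mobius_den A (val z)) /
    (Im (val z) / sqnorm (mobius_den A (val z))) = a / Im (val z).
  by field; rewrite sd0 gt_eqF.
rewrite cancel -mulrBl; congr (_ / _).
rewrite /mobius_num /mobius_den; case: (val z) => x y; rewrite /sqnorm /=; ring.
Qed.

Lemma ideal_groupP z t : ideal (group_sides z) t <->
  forall A, wmx_group A -> size_at z (t, 1) <= size_at z (app A (t, 1)).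
Proof.
have z0 := plane_gt0 z; split=> [h A GA|h _ [A GA ->]] /=.
  have := h (z, act A^-1 z) (ex_intro2 _ _ _ (wmx_groupV GA) erefl).
  rewrite /= side_group ?(wmx_group_det (wmx_groupV GA))// invrK.
  by rewrite pmulr_lge0 ?invr_gt0// subr_ge0.
rewrite side_group ?(wmx_group_det GA)// divr_ge0 ?(ltW z0)// subr_ge0.
by apply: h; exact: wmx_groupV.
Qed.

Lemma dirichlet_region z : dirichlet_domain (wmx_surface R) z = region (group_sides z).
Proof.
apply/seteqP; split=> u h; first by move=> _ [A GA ->]; exact: (h A GA).
by move=> A SA; apply: (h (z, act A z)); exists A.
Qed.

End Minimizers.

(** * Separation of the gaps by axes *)

Section InfinitelyManySides.
Variable R : realType.
Implicit Types (A B : 'M[R]_2) (z : plane R) (v : R * R) (w : seq letter) (t : R) (j k : nat).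

Definition cross (u v : R * R) : R := u.1 * v.2 - u.2 * v.1.

Lemma cross_app A u v : cross (app A u) (app A v) = \det A * cross u v.
Proof. by rewrite det2 /cross /app /=; ring. Qed.

(** The quadratic form whose zeros are the two fixed points of the [j]-th
    generator; it is negative between them. *)
Definition axis_form j v : R := cross v (app (gen R (j, true)) v).

Lemma axis_formE j v : axis_form j v =
  ((v.1 / radius R j) ^+ 2 - (shift R j + 3) * (v.1 / radius R j) * v.2
    + (3 * shift R j + 1) * v.2 ^+ 2) * radius R j.
Proof.
have r0 : radius R j != 0 by rewrite gt_eqF ?radius_gt0.
by rewrite /axis_form /cross /app /gen !mxE /=; field.
Qed.

Lemma axis_form_gen j b v : axis_form j (app (gen R (j, b)) v) = axis_form j v.
Proof.
rewrite /axis_form; case: b; first by rewrite cross_app det_gen mul1r.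
rewrite -appM; have := gen_linv R (j, false); rewrite /linv /= => ->.
rewrite app1 -[X in cross _ X]app1 -(gen_linv R (j, true)) appM /linv /=.
by rewrite cross_app det_gen mul1r.
Qed.

Lemma axis_form_ge0 j v :
  `|v.1| <= radius R j * `|v.2| \/ radius R j.+1 * `|v.2| <= `|v.1| ->
  0 <= axis_form j v.
Proof.
have r0 := radius_gt0 R j; have D9 := shift_ge9 R j.
rewrite axis_formE radiusS; move: (shift R j) D9 => D D9 h.
apply: mulr_ge0; last exact: ltW.
have [x xE] : exists x, v.1 = x * radius R j by exists (v.1 / radius R j); rewrite mulfVK ?gt_eqF.
rewrite xE mulfK ?gt_eqF//; move: h; rewrite xE normrM (gtr0_norm r0).
rewrite (mulrC (radius R j)) [_ * radius R j * _]mulrAC !ler_pM2r//.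
move: v.2 => y; have xy : x * y <= `|x| * `|y| by rewrite -normrM ler_norm.
rewrite -(@real_normK _ x) ?num_real// -(@real_normK _ y) ?num_real//.
have x0 : 0 <= `|x| by []. have y0 : 0 <= `|y| by [].
have h1 : (D + 3) * x * y <= (D + 3) * (`|x| * `|y|).
  by rewrite -mulrA ler_wpM2l//; lra.
move: `|x| `|y| x0 y0 xy h1 => X Y X0 Y0 xy h1.
case=> h.
  have h2 : (D + 3) * (X * Y) <= (D + 3) * (Y * Y).
    by rewrite ler_wpM2l//; [lra|rewrite ler_wpM2r].
  have : 0 <= (2 * D - 2) * (Y * Y) by rewrite mulr_ge0 ?mulr_ge0//; lra.
  have := mulr_ge0 X0 X0; rewrite !expr2; lra.
have h2 : (D + 3) * Y <= X by apply: le_trans h; rewrite ler_wpM2r//; lra.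
have h3 : 0 <= X * (X - (D + 3) * Y) by rewrite mulr_ge0//; lra.
have : 0 <= (3 * D + 1) * (Y * Y) by rewrite mulr_ge0 ?mulr_ge0//; lra.
rewrite !expr2; lra.
Qed.

(** The slope [6 r] lies between the annuli of a generator, which ends at [5 r],
    and of its inverse, which starts at [3 D r / 4]. *)
Definition gap k : R * R := (6 * radius R k, 1).

Lemma gap_outside k s : outside s (gap k).
Proof.
rewrite /outside /gap /= normr1 !mulr1 gtr0_norm; last by rewrite mulr_gt0 ?radius_gt0.
have rk := radius_gt0 R k; have Dk := shift_ge9 R k.
have [sk|ks|sk] := ltngtP s.1 k.
- right; apply: le_trans (hi_le_radius R s) _; apply: le_trans (radius_le R sk) _; lra.
- left; apply: le_trans (radius_le_lo R s); apply: le_trans (radius_le R ks).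
  by rewrite radiusS ler_wpM2r//; lra.
- rewrite /lo /hi sk; case: s.2; [right|left]; rewrite ler_wpM2r//; lra.
Qed.

Lemma axis_form_gap k : axis_form k (gap k) < 0.
Proof.
have r0 := radius_gt0 R k; have D9 := shift_ge9 R k.
rewrite axis_formE /gap /= mulfK ?gt_eqF// pmulr_llt0//; lra.
Qed.

(** No translate of the gap [k] enters the interval between the fixed points of
    the [j]-th generator: a letter of index [j] preserves this interval, and any
    other letter leads to an annulus that is disjoint from it. *)
Lemma axis_form_word j k w : j != k -> reduced w ->
  0 <= axis_form j (app (wmx R w) (gap k)).
Proof.
move=> jk; elim: w => [_|s w IH rsw].
  rewrite /wmx big_nil app1; apply: axis_form_ge0.
  rewrite /gap /= normr1 !mulr1 gtr0_norm; last by rewrite mulr_gt0 ?radius_gt0.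
  have rk := radius_gt0 R k; have Dk := shift_ge9 R k.
  case: (ltngtP j k) jk => // jk _; [right|left].
    by apply: le_trans (radius_le R jk) _; lra.
  by apply: le_trans (radius_le R jk); rewrite radiusS ler_wpM2r//; lra.
have [sj|sj] := eqVneq s.1 j.
  rewrite wmx_cons appM; case: s sj {rsw} (reduced_cons rsw) => n b /= -> rw.
  by rewrite axis_form_gen; exact: IH.
have [_ _ /(_ _ _ erefl)[h1 h2]] :=
  word_expand rsw (fun s' _ _ => gap_outside k (linv s')).
apply: axis_form_ge0; case: (ltngtP s.1 j) sj => // sj _; [left|right].
  apply: le_trans h2 _; rewrite ler_wpM2r//.
  exact: le_trans (hi_le_radius R s) (radius_le R sj).
apply: le_trans h1; rewrite ler_wpM2r//.
exact: le_trans (radius_le R sj) (radius_le_lo R s).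
Qed.

(** A fixed point of a hyperbolic element is not an ideal point: the element or
    its inverse makes the corresponding eigenvector shorter. *)
Lemma axis_not_ideal z A j t : wmx_group A -> ideal (group_sides z) t ->
  axis_form j (app A (t, 1)) != 0.
Proof.
move=> GA /ideal_groupP Kt; apply/eqP => f0.
have z0 := plane_gt0 z; have dA := wmx_group_det GA.
have uA : A \is a GRing.unit by rewrite unitmxE dA unitr1.
have Gg b : wmx_group (gen R (j, b)) by rewrite -wmx1; exact: wmx_group_word.
set u := app A (t, 1) in f0.
have AVu : app A^-1 u = (t, 1) by rewrite /u -appM mulVr// app1.
have u0 : u <> (0, 0).
  by move=> uE; have := AVu; rewrite uE /app /= !mulr0 addr0 => -[_ /eqP];
    rewrite eq_sym oner_eq0.
pose tr : R := 3 - shift R j.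
have trE : app (gen R (j, false)) u = (tr * u.1 - (app (gen R (j, true)) u).1,
                                     tr * u.2 - (app (gen R (j, true)) u).2).
  by rewrite /app /gen !mxE /= /tr; congr (_, _); ring.
have [m mE] : exists m, app (gen R (j, true)) u = (m * u.1, m * u.2).
  move: f0 u0; rewrite /axis_form /cross; case: (app _ u) => p q; case: (u) => x y /=.
  move=> /eqP; rewrite subr_eq0 => /eqP E xy0; have [x0|x0] := eqVneq x 0.
    have [y0|y0] := eqVneq y 0; first by case: xy0; rewrite x0 y0.
    exists (q / y); rewrite mulfVK// x0 mulr0; congr (_, _).
    by apply: (mulfI y0); rewrite -E x0 mul0r mulr0.
  exists (p / x); rewrite mulfVK//; congr (_, _); apply: (mulfI x0).
  by rewrite E; field.
rewrite mE in trE.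
have sz : 0 < size_at z (t, 1).
  rewrite /size_at [(t, 1).2]/= !mulr1.
  by apply: ltr_wpDl; [exact: sqr_ge0|exact: exprn_gt0].
have big b c : app (gen R (j, b)) u = (c * u.1, c * u.2) -> 1 <= c ^+ 2.
  move=> bE; have := Kt _ (wmx_groupM (wmx_groupV GA) (wmx_groupM (Gg b) GA)).
  rewrite !appM -/u bE.
  have -> : app A^-1 (c * u.1, c * u.2) = (c * ((t, 1) : R * R).1, c * ((t, 1) : R * R).2).
    by rewrite -AVu /app /=; congr (_, _); ring.
  by rewrite size_at_scale -[leLHS]mul1r ler_pM2r.
have m1 : 1 <= m ^+ 2 by exact: big mE.
have m2 : 1 <= (tr - m) ^+ 2.
  by apply: (big false); rewrite trE /=; congr (_, _); ring.
have mm : m * (tr - m) = 1.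
  have : app (gen R (j, false)) (app (gen R (j, true)) u) = u.
    by rewrite -appM; have := gen_linv R (j, true); rewrite /linv /= => ->; rewrite app1.
  rewrite mE (_ : app _ _ = (m * (app (gen R (j, false)) u).1, m * (app (gen R (j, false)) u).2)); last first.
    by rewrite /app /=; congr (_, _); ring.
  rewrite trE; move: u u0 {trE mE big AVu f0} => [x y] /= xy0 [h1 h2].
  have [x0|x0] := eqVneq x 0.
    have y0 : y != 0 by apply/eqP => y0; apply: xy0; rewrite x0 y0.
    by apply: (mulIf y0); rewrite mul1r -[RHS]h2; ring.
  by apply: (mulIf x0); rewrite mul1r -[RHS]h1; ring.
have tr6 : tr <= - 6 by rewrite /tr; have := shift_ge9 R j; lra.
have E1 : m ^+ 2 * (tr - m) ^+ 2 = 1 by rewrite -exprMn mm expr1n.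
have : tr ^+ 2 = m ^+ 2 + (tr - m) ^+ 2 + 2 * (m * (tr - m)) by ring.
rewrite mm; move: m1 m2 E1; move: (m ^+ 2) ((tr - m) ^+ 2) => a b a1 b1 E1 E2.
nra.
Qed.

End InfinitelyManySides.

(** * Geometric infiniteness *)

Section GeometricallyInfinite.
Variable R : realType.
Implicit Types (A B : 'M[R]_2) (z : plane R) (t : R) (j k : nat).

Lemma hdist_center_le z w : hdist z z <= hdist z w.
Proof.
have z0 := plane_gt0 z; have w0 := plane_gt0 w.
rewrite /hdist acosh_le ?lerDl ?divr_ge0 ?addr_ge0 ?sqr_ge0 ?mulr_ge0 ?(ltW z0) ?(ltW w0)//.
rewrite subrr /sqnorm /= expr0n addr0 mul0r addr0 lerDl.
by rewrite divr_ge0 ?addr_ge0 ?sqr_ge0 ?mulr_ge0 ?(ltW z0) ?(ltW w0).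
Qed.

(** Every gap has a translate among the ideal points of a Dirichlet domain,
    namely one at which the size seen from the center is minimal. *)
Lemma gap_ideal z k : exists A, [/\ wmx_group A, (app A (gap R k)).2 != 0
  & ideal (group_sides z) ((app A (gap R k)).1 / (app A (gap R k)).2)].
Proof.
have [A GA Amin] := orbit_min z (@gap_outside R k) erefl.
exists A; have y0 : (app A (gap R k)).2 != 0.
  case: GA => w rw AE.
  have := word_snd rw (fun s _ _ => @gap_outside R k (linv s)).
  rewrite [X in `|X| <= _]/= normr1 -normr_gt0 => /(lt_le_trans ltr01).
  by case: AE => ->//; rewrite appN [(_, _).2]/= normrN.
split=> //; apply/ideal_groupP => B GB; set v := app A (gap R k) in y0 Amin *.
have vE : v = (v.2 * (v.1 / v.2), v.2 * 1).
  by rewrite mulr1 mulrC divfK//; case: (v).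
have v0 : 0 < v.2 ^+ 2 by rewrite lt_neqAle sqr_ge0 andbT eq_sym expf_neq0.
rewrite -(ler_pM2l v0) -!size_at_scale -vE.
rewrite (_ : (_, _) = app B v); first by rewrite /v -appM; exact: Amin (wmx_groupM GB GA).
by rewrite [in RHS]vE /app /=; congr (_, _); ring.
Qed.

(** The form of the axis of [j], transported by [A], is negative at the translate
    of the gap [j] and nonnegative at any translate of the gap [k]: it vanishes
    in between. *)
Lemma axis_between j k A B a b : wmx_group A -> wmx_group B -> j != k ->
  (app A (gap R j)).2 != 0 -> (app B (gap R k)).2 != 0 ->
  a = (app A (gap R j)).1 / (app A (gap R j)).2 ->
  b = (app B (gap R k)).1 / (app B (gap R k)).2 ->
  exists2 t, Num.min a b <= t <= Num.max a b & axis_form j (app A^-1 (t, 1)) = 0.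
Proof.
move=> GA GB jk y0 y0' aE bE.
have uA : A \is a GRing.unit by rewrite unitmxE (wmx_group_det GA) unitr1.
have scale (c : R) (v : R * R) (C : 'M[R]_2) : app C (c * v.1, c * v.2) =
    (c * (app C v).1, c * (app C v).2).
  by rewrite /app /=; congr (_, _); ring.
have form_scale (c : R) (v : R * R) : axis_form j (c * v.1, c * v.2) = c ^+ 2 * axis_form j v.
  by rewrite /axis_form scale /cross /=; ring.
have normalize (v : R * R) : v.2 != 0 -> (v.1 / v.2, 1) = (v.2^-1 * v.1, v.2^-1 * v.2).
  by move=> v0; rewrite mulVf// mulrC.
have fa : axis_form j (app A^-1 (a, 1)) < 0.
  rewrite aE normalize// scale form_scale -appM mulVr// app1.
  by rewrite pmulr_rlt0 ?axis_form_gap// lt_neqAle sqr_ge0 eq_sym expf_neq0// invr_eq0.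
have fb : 0 <= axis_form j (app A^-1 (b, 1)).
  rewrite bE normalize// scale form_scale -appM mulr_ge0 ?sqr_ge0//.
  have [w rw AE] := wmx_groupM (wmx_groupV GA) GB.
  have := @axis_form_word R _ _ _ jk rw; case: AE => ->//.
  rewrite appN; have := form_scale (-1) (app (wmx R w) (gap R k)).
  by rewrite !mulN1r sqrrN expr1n mul1r => ->.
pose l1 : {poly R} := A^-1 0 0 *: 'X + (A^-1 0 1)%:P.
pose l2 : {poly R} := A^-1 1 0 *: 'X + (A^-1 1 1)%:P.
pose g := gen R (j, true).
pose f := g 1 0 *: (l1 * l1) + (g 1 1 - g 0 0) *: (l1 * l2) - g 0 1 *: (l2 * l2).
have fE t : f.[t] = axis_form j (app A^-1 (t, 1)).
  rewrite /f /l1 /l2 /axis_form -/g /cross {1 2}/app /=.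
  rewrite hornerD hornerN hornerD !hornerZ !hornerM !hornerD !hornerZ !hornerX !hornerC.
  by rewrite /app /=; ring.
rewrite -!fE in fa fb.
have [ab|ba] := leP a b.
  have [|t tab /rootP ft] := @poly_ivt _ f a b ab; first by rewrite (ltW fa).
  by exists t; rewrite -?fE.
have [|t tab /rootP ft] := @poly_ivt _ (- f) b a (ltW ba).
  by rewrite !hornerN oppr_le0 oppr_ge0 fb ltW.
exists t => //; rewrite -fE; apply/eqP; rewrite -oppr_eq0 -hornerN; exact/eqP.
Qed.

Lemma count_le_eq (s : seq R) a b : a <= b ->
  count (fun r => r <= a) s = count (fun r => r <= b) s ->
  forall r, r \in s -> a < r -> r <= b -> False.
Proof.
move=> ab E r rs ar rb.
have gt0 : (0 < count (fun r => (a < r <= b)%R) s)%N.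
  by rewrite -has_count; apply/hasP; exists r; rewrite // ar rb.
have split_count : count (fun r => r <= b) s =
    (count (fun r => (r <= a)%R) s + count (fun r => (a < r <= b)%R) s)%N.
  elim: s {E rs gt0} => //= x s ->; rewrite addnACA; congr (_ + _)%N.
  by case: (leP x a) => xa /=; [rewrite (le_trans xa ab)|].
by move: gt0; rewrite split_count -[LHS]addn0 in E; move/addnI: E => <-.
Qed.

(** Among the translates of the gaps at infinity of a polygon, two have the same
    number of roots of the side polynomials on their left, so that the segment
    between them is at infinity of the polygon as well. *)
Lemma wmx_geometrically_infinite : geometrically_infinite (wmx_surface R).
Proof.
move=> [z [s [/allP snd DE]]].
pose P' : set (plane R * plane R) := [set pq | pq \in s].
have PP' : ideal (group_sides z) = ideal P'.
  apply: (@ideal_eq _ _ _ z); last by rewrite -dirichlet_region DE.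
  by move=> _ [A GA ->]; exact: hdist_center_le.
have [A AP] := choice (gap_ideal z).
pose tau k := (app (A k) (gap R k)).1 / (app (A k) (gap R k)).2.
have tauK k : ideal P' (tau k) by rewrite -PP'; have [] := AP k.
pose rts := flatten [seq polyrcf.rootsR (side_poly pq.1 pq.2) | pq <- s].
pose cnt k := count (fun r => r <= tau k) rts.
have [j [k [jk cjk]]] : exists j k, j != k /\ cnt j = cnt k.
  pose f (i : 'I_(size rts).+2) : 'I_(size rts).+1 := inord (cnt i).
  have ninj : ~~ injectiveb f.
    by apply/negP => /injectiveP/leq_card; rewrite !card_ord ltnn.
  have [j [k jk /(congr1 val)]] := elimT (injectivePn f) ninj; rewrite /= !inordK ?ltnS ?count_size// => E.
  by exists j, k.
have segment a b : ideal P' a -> ideal P' b -> a <= b ->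
    count (fun r => r <= a) rts = count (fun r => r <= b) rts ->
    forall t, a <= t <= b -> ideal P' t.
  move=> Ka Kb ab cab t /andP[at_ tb] pq pqs; rewrite leNgt; apply/negP => neg.
  have ta : t != a by apply: contraTneq neg => ->; rewrite -leNgt; exact: Ka.
  have {ta at_} at_ : a < t by rewrite lt_neqAle eq_sym ta.
  have [|r /andP[tr rb] rr] := @poly_ivt _ (side_poly pq.1 pq.2) t b tb.
    by rewrite !side_polyE (ltW neg); exact: Kb.
  apply: (count_le_eq ab cab _ (lt_le_trans at_ tr) rb).
  apply/flattenP; exists (polyrcf.rootsR (side_poly pq.1 pq.2)).
    by apply/mapP; exists pq.
  by rewrite -polyrcf.roots_on_rootsR ?side_poly_neq0 ?snd// rr in_itv.
have [t tjk t0] : exists2 t, Num.min (tau j) (tau k) <= t <= Num.max (tau j) (tau k) &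
    axis_form j (app (A j)^-1 (t, 1)) = 0.
  have [GAj yj _] := AP j; have [GAk yk _] := AP k.
  exact: axis_between GAj GAk jk yj yk erefl erefl.
have : ideal P' t.
  have [jk'|kj'] := leP (tau j) (tau k).
    by apply: (segment _ _ _ _ jk' cjk) => //; move: tjk; rewrite (min_idPl jk') (max_idPr jk').
  apply: (segment _ _ _ _ (ltW kj') (esym cjk)) => //.
  by move: tjk; rewrite (min_idPr (ltW kj')) (max_idPl (ltW kj')).
rewrite -PP' => Kt; have [GAj _ _] := AP j.
by have := axis_not_ideal j (wmx_groupV GAj) Kt; rewrite t0 eqxx.
Qed.

End GeometricallyInfinite.

Theorem theorem1p1 (R : realType) :
  exists Sigma : {delta : R | 1 < delta} -> hyperbolic_surface R,
  forall delta : {delta : R | 1 < delta},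
    geometrically_infinite (Sigma delta) /\
    exists2 u0 : T1surface (Sigma delta), nonwandering u0 &
      [/\ irregular_orbit u0, asymptotic_fineness u0 = +oo%E,
          ~ horocyclic_minimal (closure (horocyclic_orbit u0))
        & exists t : nat -> R,
            (forall n, (1 <= n)%N -> return_times u0 (t n)) /\
            t n @[n --> \oo] --> +oo].
Proof.
exists (fun _ => wmx_surface R) => _; split; first exact: wmx_geometrically_infinite.
exists (u0 R); first by have [] := irregular_u0 R.
split; [exact: irregular_u0|exact: asymptotic_fineness_u0|exact: not_minimal_u0|].
exists (fun n => n%:R * (2 * ln 3)); split; last exact: return_times_cvg.
exact: return_times_u0.
Qed.
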